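(* Let $K=\mathbb{Q}(\sqrt{2})$ with ring of integers $\mathcal{O}_K$, and let $|q|<1$. Define \[ L_{1}(q) := \sum_{n \geq 1} \sum_{k=1}^{n} \frac{(q)_{n-1}(-1)^{n+k}q^{\binom{n+1}{2} + \binom{k+1}{2}} }{(q)_{n-k} (q)_{k-1} (1-q^{2k-1})},\qquad L_{2}(q) := \sum_{n \geq 0} \sum_{k=0}^{n} \frac{(q)_{n}(-1)^{n+k}q^{\binom{n+1}{2} + \binom{k+1}{2}} }{(q)_{n-k} (q)_{k} (1-q^{2k+1})}, \] \[ L_{3}(q) := q \sum_{n \geq 1} \sum_{k=1}^{n} \frac{(q)_{n-1}(-1)^{n+k}q^{\binom{n+1}{2} + \binom{k}{2}} }{(q)_{n-k} (q)_{k-1} (1-q^{2k-1})},\qquad L_{4}(q) := -1 + \sum_{n \geq 0} \sum_{k=0}^{n} \frac{(q)_{n}(-1)^{n+k}q^{\binom{n+1}{2}+ \binom{k}{2}} }{(q)_{n-k} (q)_{k} (1-q^{2k+1})}. \] Then \[ q^{-17} L_{1}(q^{32}) = \frac{1}{2} \sum_{\substack{\mathfrak{a} \subset \mathcal{O}_{K} \\ N(\mathfrak{a}) \equiv 15 \pmod{32}}} q^{N(\mathfrak{a})},\qquad q^{7} L_{2}(q^{32}) = \frac{1}{2} \sum_{\substack{\mathfrak{a} \subset \mathcal{O}_{K} \\ N(\mathfrak{a}) \equiv 7 \pmod{32}}} q^{N(\mathfrak{a})}, \] \[ q^{-33} L_{3}(q^{32}) = \frac{1}{2} \sum_{\substack{\mathfrak{a}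 \subset \mathcal{O}_{K} \\ N(\mathfrak{a}) \equiv 31 \pmod{32}}} q^{N(\mathfrak{a})},\qquad q^{-9} L_{4}(q^{32}) = \frac{1}{2} \sum_{\substack{\mathfrak{a} \subset \mathcal{O}_{K} \\ N(\mathfrak{a}) \equiv 23 \pmod{32}}} q^{N(\mathfrak{a})}. \]
   Context: For $n\in\mathbb{N}\cup\{\infty\}$, $(a)_n=(a;q)_n=\prod_{k=1}^{n}(1-aq^{k-1})$ (empty product $=1$). The sums on the right run over nonzero ideals $\mathfrak{a}$ of $\mathcal{O}_K$ with the given congruence condition on the absolute norm $N(\mathfrak{a})$ (each ideal counted once). *)

(* Defs.v *)
From Stdlib Require Import Reals ZArith Arith List ClassicalEpsilon.
From Coquelicot Require Import Coquelicot.

Fixpoint qpoch (a q : C) (n : nat) : C :=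
  match n with
  | O => RtoC 1
  | S m => Cmult (qpoch a q m) (Cminus (RtoC 1) (Cmult a (pow_n q m)))
  end.

Definition qp (q : C) (n : nat) : C := qpoch q q n.

Definition binom2 (m : nat) : nat := (m * (m - 1)) / 2.

Definition sgn (m : nat) : C := pow_n (RtoC (-1)) m.

Definition cdiv (x y : C) : C := Cmult x (Cinv y).

Definition L1_term (q : C) (n : nat) : C :=
  sum_n_m (fun k =>
    cdiv (Cmult (Cmult (qp q (n - 1)) (sgn (n + k))) (pow_n q (binom2 (n + 1) + binom2 (k + 1))))
         (Cmult (Cmult (qp q (n - k)) (qp q (k - 1))) (Cminus (RtoC 1) (pow_n q (2 * k - 1)))))
    1 n.

Definition L2_term (q : C) (n : nat) : C :=
  sum_n_m (fun k =>
    cdiv (Cmult (Cmult (qp q n) (sgn (n + k))) (pow_n q (binom2 (n + 1) + binom2 (k + 1))))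
         (Cmult (Cmult (qp q (n - k)) (qp q k)) (Cminus (RtoC 1) (pow_n q (2 * k + 1)))))
    0 n.

(** L3(q) = q * sum of these terms *)
Definition L3_term (q : C) (n : nat) : C :=
  sum_n_m (fun k =>
    cdiv (Cmult (Cmult (qp q (n - 1)) (sgn (n + k))) (pow_n q (binom2 (n + 1) + binom2 k)))
         (Cmult (Cmult (qp q (n - k)) (qp q (k - 1))) (Cminus (RtoC 1) (pow_n q (2 * k - 1)))))
    1 n.

(** L4(q) = -1 + sum of these terms *)
Definition L4_term (q : C) (n : nat) : C :=
  sum_n_m (fun k =>
    cdiv (Cmult (Cmult (qp q n) (sgn (n + k))) (pow_n q (binom2 (n + 1) + binom2 k)))
         (Cmult (Cmult (qp q (n - k)) (qp q k)) (Cminus (RtoC 1) (pow_n q (2 * k + 1)))))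
    0 n.

(** The ring of integers of Q(sqrt 2) is Z[sqrt 2]; (a, b) represents a + b sqrt 2. *)
Definition OK : Type := (Z * Z)%type.
Definition OK_add (x y : OK) : OK := (fst x + fst y, snd x + snd y)%Z.
Definition OK_sub (x y : OK) : OK := (fst x - fst y, snd x - snd y)%Z.
Definition OK_mul (x y : OK) : OK :=
  (fst x * fst y + 2 * snd x * snd y, fst x * snd y + snd x * fst y)%Z.

Definition is_ideal (I : OK -> Prop) : Prop :=
  I (0, 0)%Z /\
  (forall x y, I x -> I y -> I (OK_add x y)) /\
  (forall r x, I x -> I (OK_mul r x)).

(** absolute norm N(I) = [O_K : I] = m : there are exactly m residue classes
    modulo I (witnessed by representatives f 0, ..., f (m-1)).  Only nonzero
    ideals have finite index. *)
Definition ideal_norm_is (I : OK -> Prop) (m : nat) : Prop :=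
  exists f : nat -> OK,
    (forall i j, (i < m)%nat -> (j < m)%nat -> I (OK_sub (f i) (f j)) -> i = j) /\
    (forall x, exists i, (i < m)%nat /\ I (OK_sub x (f i))).

Definition same_set (I J : OK -> Prop) : Prop := forall x, I x <-> J x.

Definition has_n_ideals_of_norm (m n : nat) : Prop :=
  exists L : list (OK -> Prop),
    length L = n /\
    (forall I, In I L -> is_ideal I /\ ideal_norm_is I m) /\
    (forall i j, (i < n)%nat -> (j < n)%nat ->
        same_set (nth i L (fun _ => False)) (nth j L (fun _ => False)) -> i = j) /\
    (forall I, is_ideal I -> ideal_norm_is I m -> exists J, In J L /\ same_set I J).

Definition num_ideals (m : nat) : nat :=
  epsilon (inhabits 0%nat) (fun n => has_n_ideals_of_norm m n).

Definition ideal_term (r : nat) (q : C) (m : nat) : C :=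
  if Nat.eqb (m mod 32) r then Cmult (RtoC (INR (num_ideals m))) (pow_n q m) else RtoC 0.

(* Main.v *)
Require Import Defs.
From Stdlib Require Import Reals ZArith Arith List FinFun Lia Lra ClassicalEpsilon.
From Coquelicot Require Import Coquelicot.
(** Write [Q = q^32 = p^2] with [p = q^16]. Expanding [1/(Q)_{n-k}] in the Bailey
  kernels [1/((Q)_{n-r} (Q)_{n+r+d+1})], with [d = 0] for L2, L4 and [d = 1] for
  L1, L3, and summing over [n] turns each double sum into a single sum over [r].
  Its [r]-th term involves [1/(1-Q^{2k+1})] or [Q^k/(1-Q^{2k+1})], which are, up to a
  power of [p], the even and odd parts in [p] of [1/(1-p^{2k+1})]; with the latter
  denominator the inner sum over [k] equals [sum_i p^{-i(i+1)/2}] times an elementary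
  factor, by a two-step recurrence in [r].
  So each L is a sum of [q^{x^2-2y^2}] over odd [x, y > 0] with [2y < x], and the parity
  in [p] selects the residue mod 32. Finally Z[sqrt 2] is principal with a unit of norm
  -1, and every ideal of norm [m = 7 mod 8] has exactly one generator [x + y sqrt 2] of
  norm [m] with [x > 0] and [2|y| < x]; the sign of [y] accounts for the factor 1/2. *)

Open Scope C_scope.

(** * Finite sums and integer powers *)

(** No infinite double sum is rearranged. The passage from [n] to [r] is an exact identity for every
    truncation [N], because all kernels vanish outside a triangle; the one analytic question is how
    fast the truncated conjugate sums reach their limit. Their error carries [|q|^((N+1)(N+2)/2)],
    while the q-factorials and their inverses grow at most exponentially in [N], so crude bounds
    suffice. Convergence of the L series is not shown directly: it is inherited from the Hecke-type
    sums, whose exponents [x^2 - 2y^2] are at least [x]. L4 does not fit the parity pattern at once: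
    its [q^{-k}/(1-q^{2k+1})] exceeds [q^{k+1}/(1-q^{2k+1})] by [q^{-k}], and this surplus sums to
    the 1 that the summand -1 removes. The q-identities are proved by first-order recurrences with
    explicit telescoping certificates, so that each verification is a rational identity in a few
    powers of [q]. *)

Fixpoint csum (f : nat -> C) (n : nat) : C :=
  match n with O => 0 | S m => csum f m + f m end.

Lemma csum_ext (f g : nat -> C) (n : nat) :
  (forall i, (i < n)%nat -> f i = g i) -> csum f n = csum g n.
Proof.
  induction n as [|n IH]; simpl; intros H; [reflexivity|].
  rewrite IH by (intros; apply H; lia). now rewrite H by lia.
Qed.

Lemma csum_plus (f g : nat -> C) (n : nat) :
  csum (fun i => f i + g i) n = csum f n + csum g n.
Proof. induction n as [|n IH]; simpl; [ring|rewrite IH; ring]. Qed.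

Lemma csum_scal (c : C) (f : nat -> C) (n : nat) :
  csum (fun i => c * f i) n = c * csum f n.
Proof. induction n as [|n IH]; simpl; [ring|rewrite IH; ring]. Qed.

Lemma csum_zero (f : nat -> C) (n : nat) :
  (forall i, (i < n)%nat -> f i = 0) -> csum f n = 0.
Proof.
  induction n as [|n IH]; simpl; intros H; [reflexivity|].
  rewrite IH by (intros; apply H; lia). rewrite H by lia. ring.
Qed.

Lemma csum_swap (f : nat -> nat -> C) (n m : nat) :
  csum (fun i => csum (f i) m) n = csum (fun j => csum (fun i => f i j) n) m.
Proof.
  induction n as [|n IH]; simpl.
  - symmetry; apply csum_zero; reflexivity.
  - now rewrite IH, <- csum_plus.
Qed.

Lemma csum_first (f : nat -> C) (n : nat) :
  csum f (S n) = f O + csum (fun i => f (S i)) n.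
Proof. induction n as [|n IH]; simpl in *; [ring|rewrite IH; ring]. Qed.

Lemma csum_telescope (f : nat -> C) (n : nat) :
  csum (fun i => f (S i) - f i) n = f n - f O.
Proof. induction n as [|n IH]; simpl; [ring|rewrite IH; ring]. Qed.

Lemma csum_extend (f : nat -> C) (n m : nat) :
  (n <= m)%nat -> (forall i, (n <= i < m)%nat -> f i = 0) -> csum f m = csum f n.
Proof.
  induction 1 as [|m Hm IH]; intros H; [reflexivity|].
  simpl. rewrite IH by (intros; apply H; lia). rewrite H by lia. ring.
Qed.

Lemma Cmod_csum_le (f : nat -> C) (n : nat) (M : R) :
  (forall i, (i < n)%nat -> (Cmod (f i) <= M)%R) -> (Cmod (csum f n) <= INR n * M)%R.
Proof.
  induction n as [|n IH]; intros H.
  - simpl. rewrite Cmod_0. lra.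
  - rewrite S_INR. simpl csum. eapply Rle_trans; [apply Cmod_triangle|].
    specialize (IH ltac:(intros; apply H; lia)). specialize (H n ltac:(lia)). lra.
Qed.

Lemma sum_n_m_csum (f : nat -> C) (n : nat) : sum_n_m f 0 n = csum f (S n).
Proof.
  induction n as [|n IH].
  - rewrite sum_n_n. simpl. ring.
  - rewrite sum_n_Sm, IH by lia. reflexivity.
Qed.

(** Integer exponents are needed because the Bailey coefficients carry powers such as [q^{-(r+d)k}].
    At [q = 0] additivity fails, hence the hypothesis [q <> 0] below and the separate case in the
    theorem. *)
Definition zpow (q : C) (z : Z) : C :=
  if (0 <=? z)%Z then q ^ (Z.to_nat z) else / q ^ (Z.to_nat (- z)).

Lemma zpow_nat (q : C) (n : nat) : zpow q (Z.of_nat n) = q ^ n.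
Proof.
  unfold zpow. destruct (Z.leb_spec 0 (Z.of_nat n)); [|lia]. now rewrite Nat2Z.id.
Qed.

Lemma zpow_sub_nat (q : C) (m n : nat) :
  q <> 0 -> zpow q (Z.of_nat m - Z.of_nat n) = q ^ m / q ^ n.
Proof.
  intros hq. assert (H := fun k => Cpow_nz q k hq).
  unfold zpow. destruct (Z.leb_spec 0 (Z.of_nat m - Z.of_nat n)).
  - replace (Z.to_nat _) with (m - n)%nat by lia.
    replace m with (n + (m - n))%nat at 2 by lia. rewrite Cpow_add_r. field. auto.
  - replace (Z.to_nat _) with (n - m)%nat by lia.
    replace n with (m + (n - m))%nat at 2 by lia. rewrite Cpow_add_r. field. auto.
Qed.

Lemma zpow_add (q : C) (a b : Z) : q <> 0 -> zpow q (a + b) = zpow q a * zpow q b.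
Proof.
  intros hq. assert (H := fun k => Cpow_nz q k hq).
  assert (E : forall z, z = (Z.of_nat (Z.to_nat z) - Z.of_nat (Z.to_nat (- z)))%Z) by lia.
  rewrite (E a), (E b).
  set (a1 := Z.to_nat a). set (a2 := Z.to_nat (- a)).
  set (b1 := Z.to_nat b). set (b2 := Z.to_nat (- b)).
  replace (_ + _)%Z with (Z.of_nat (a1 + b1) - Z.of_nat (a2 + b2))%Z by lia.
  rewrite !zpow_sub_nat by assumption. rewrite !Cpow_add_r. field. auto.
Qed.

Lemma zpow_0 (q : C) : zpow q 0 = 1.
Proof. reflexivity. Qed.

Lemma zpow_1 (q : C) : zpow q 1 = q.
Proof. unfold zpow. simpl. ring. Qed.

Lemma zpow_nz (q : C) (a : Z) : q <> 0 -> zpow q a <> 0.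
Proof.
  intros hq E. assert (H : zpow q (a + - a) = 1) by (rewrite Z.add_opp_diag_r; reflexivity).
  rewrite zpow_add, E, Cmult_0_l in H by assumption. apply C1_nz. now symmetry.
Qed.

Lemma zpow_opp (q : C) (a : Z) : q <> 0 -> zpow q (- a) = / zpow q a.
Proof.
  intros hq. assert (Ha := zpow_nz q a hq).
  assert (H : zpow q (a + - a) = 1) by (rewrite Z.add_opp_diag_r; reflexivity).
  rewrite zpow_add in H by assumption.
  replace (zpow q (- a)) with (zpow q a * zpow q (- a) / zpow q a) by (field; assumption).
  rewrite H. field. assumption.
Qed.

Lemma zpow_double (q : C) (a : Z) : q <> 0 -> zpow q (2 * a) = zpow q a * zpow q a.
Proof. intros. rewrite <- zpow_add by assumption. f_equal. lia. Qed.

Lemma zpow_zpow (p : C) (a b : Z) : p <> 0 -> zpow (zpow p a) b = zpow p (a * b).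
Proof.
  intros hp. assert (hpa := zpow_nz p a hp).
  assert (N : forall n, zpow (zpow p a) (Z.of_nat n) = zpow p (a * Z.of_nat n)).
  { induction n as [|n IH].
    - rewrite Z.mul_0_r. reflexivity.
    - rewrite Nat2Z.inj_succ. unfold Z.succ. rewrite zpow_add, IH, zpow_1 by assumption.
      rewrite <- zpow_add by assumption. f_equal. lia. }
  destruct (Z.le_ge_cases 0 b).
  - rewrite <- (Z2Nat.id b) by assumption. apply N.
  - replace b with (- Z.of_nat (Z.to_nat (- b)))%Z by lia.
    rewrite zpow_opp, N, <- zpow_opp by assumption. f_equal. lia.
Qed.

(** The substitution of [- p] for [p] detects the parity of an exponent, which is how residues mod
    32 are separated later. *)
Lemma zpow_opp_base (p : C) (a : Z) : p <> 0 ->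
  zpow (- p) a = (if Z.even a then 1 else - (1)) * zpow p a.
Proof.
  intros hp.
  assert (hp' : - p <> 0).
  { intros E. apply hp. replace p with (- - p) by ring. rewrite E. ring. }
  assert (D : forall b, zpow (- p) (2 * b) = zpow p (2 * b)).
  { intros b. rewrite <- !zpow_zpow by assumption. f_equal.
    change 2%Z with (1 + 1)%Z. rewrite !zpow_add, !zpow_1 by assumption. ring. }
  destruct (Z.even a) eqn:E.
  - apply Z.even_spec in E. destruct E as [b ->]. rewrite D. ring.
  - assert (O : Z.odd a = true) by (rewrite <- Z.negb_even, E; reflexivity).
    apply Z.odd_spec in O. destruct O as [b ->].
    rewrite !zpow_add, D, !zpow_1 by assumption. ring.
Qed.

Lemma Cmod_zpow_le_1 (q : C) (a : Z) :
  (Cmod q <= 1)%R -> (0 <= a)%Z -> (Cmod (zpow q a) <= 1)%R.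
Proof.
  intros hq ha. rewrite <- (Z2Nat.id a), zpow_nat, Cmod_pow by assumption.
  rewrite <- (pow1 (Z.to_nat a)). apply pow_incr. split; [apply Cmod_ge_0|assumption].
Qed.

Lemma one_minus_zpow_nz (q : C) (a : Z) :
  (Cmod q < 1)%R -> (0 < a)%Z -> 1 - zpow q a <> 0.
Proof.
  intros hq ha E. rewrite <- (Z2Nat.id a), zpow_nat in E by lia.
  assert (E' : q ^ (Z.to_nat a) = 1) by (replace (RtoC 1) with (1 - q ^ Z.to_nat a + q ^ Z.to_nat a) by ring; rewrite E; ring).
  assert (H : (Cmod (q ^ Z.to_nat a) < 1)%R).
  { rewrite Cmod_pow. apply pow_lt_1_compat; [|lia]. split; [apply Cmod_ge_0|assumption]. }
  rewrite E', Cmod_1 in H. lra.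
Qed.

(** * q-factorials *)

(** The convention [1/(q)_{-m} = 0] for [m > 0]: sums may be extended past their range, and the
    recurrences hold without side conditions. *)
Definition binv (q : C) (n k : nat) : C := if (k <=? n)%nat then / qp q (n - k) else 0.

Lemma qp_S (q : C) (n : nat) : qp q (S n) = qp q n * (1 - zpow q (Z.of_nat (S n))).
Proof. rewrite zpow_nat. reflexivity. Qed.

Lemma qp_nz (q : C) (n : nat) : (Cmod q < 1)%R -> qp q n <> 0.
Proof.
  intros hq. induction n as [|n IH]; [exact C1_nz|].
  rewrite qp_S. apply Cmult_neq_0; [exact IH|]. apply one_minus_zpow_nz; [assumption|lia].
Qed.

Lemma binv_le (q : C) (n k : nat) : (k <= n)%nat -> binv q n k = / qp q (n - k).
Proof. intros H. unfold binv. apply Nat.leb_le in H. now rewrite H. Qed.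

Lemma binv_gt (q : C) (n k : nat) : (n < k)%nat -> binv q n k = 0.
Proof. intros H. unfold binv. apply Nat.leb_gt in H. now rewrite H. Qed.

Lemma binv_SS (q : C) (n k : nat) : binv q (S n) (S k) = binv q n k.
Proof. reflexivity. Qed.

(** At [k = n + 1] the factor is [1 - q^0 = 0], so the recurrence agrees with the convention at the
    boundary. *)
Lemma binv_succ_l (q : C) (n k : nat) : (Cmod q < 1)%R ->
  binv q n k = (1 - zpow q (Z.of_nat (S n) - Z.of_nat k)) * binv q (S n) k.
Proof.
  intros hq. destruct (le_lt_dec k n) as [H|H].
  - rewrite !binv_le by lia. replace (S n - k)%nat with (S (n - k)) by lia.
    rewrite qp_S. replace (Z.of_nat (S n) - Z.of_nat k)%Z with (Z.of_nat (S (n - k))) by lia.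
    field. split; [|now apply qp_nz]. apply one_minus_zpow_nz; [assumption|lia].
  - rewrite (binv_gt _ n) by lia. destruct (Nat.eq_dec k (S n)) as [->|H'].
    + rewrite Z.sub_diag, zpow_0. ring.
    + rewrite binv_gt by lia. ring.
Qed.

Lemma binv_succ_r (q : C) (n k : nat) : (Cmod q < 1)%R ->
  binv q n (S k) = (1 - zpow q (Z.of_nat n - Z.of_nat k)) * binv q n k.
Proof.
  intros hq. rewrite <- (binv_SS q n k), (binv_succ_l q n (S k)) by assumption.
  do 3 f_equal. lia.
Qed.

Lemma zpow_2 (q : C) : zpow q 2 = q * q.
Proof. unfold zpow. simpl. ring. Qed.

(** Splits each power into a monomial in atoms like [q^r], [q^k], [q^(rk)]; a recurrence then
    becomes a rational identity that [field] decides. *)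
Ltac zexpand hq :=
  repeat rewrite ?Nat2Z.inj_succ, ?Nat2Z.inj_add; unfold Z.succ, Z.sub;
  repeat rewrite ?Z.mul_add_distr_l, ?Z.mul_add_distr_r, ?Z.mul_opp_l, ?Z.mul_opp_r,
    ?Z.mul_1_l, ?Z.mul_1_r, ?Z.opp_add_distr, ?Z.opp_involutive, <- ?Z.add_assoc;
  repeat rewrite ?(zpow_add _ _ _ hq), ?(zpow_opp _ _ hq), ?(zpow_double _ _ hq), ?zpow_2, ?zpow_1, ?zpow_0.

(* Telescoping in k of the q-Pascal recurrence in r. *)
Lemma q_binomial_sum (q b : C) (r : nat) : (Cmod q < 1)%R -> q <> 0 -> b <> 0 ->
  csum (fun k => qp q r * binv q r k / qp q k * qpoch b q k
                 * zpow b (Z.of_nat r - Z.of_nat k)) (S r) = 1.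
Proof.
  intros hq q0 b0.
  set (t := fun r k => qp q r * binv q r k / qp q k * qpoch b q k
                 * zpow b (Z.of_nat r - Z.of_nat k)).
  change (csum (t r) (S r) = 1).
  induction r as [|r IH].
  - unfold t, csum. rewrite Z.sub_diag, zpow_0, binv_le by lia. simpl.
    unfold qp. simpl. field.
  - set (s := fun k => match k with O => RtoC 0 | S j => (1 - b * zpow q (Z.of_nat j)) * t r j end).
    assert (E : forall k, t (S r) k = t r k - (s (S k) - s k)).
    { intros [|k]; unfold s, t.
      - assert (H := qp_nz q r hq).
        rewrite (binv_succ_l q r 0), qp_S by assumption.
        change (qp q 0) with (RtoC 1). change (qpoch b q 0) with (RtoC 1).
        zexpand b0. zexpand q0. field.
      - rewrite binv_SS, (binv_succ_r q r k), !qp_S by assumption.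
        assert (H := qp_nz q k hq).
        assert (H1 := one_minus_zpow_nz q (Z.of_nat (S k)) hq ltac:(lia)).
        assert (H2 := zpow_nz q (Z.of_nat k) q0).
        assert (H3 := zpow_nz b (Z.of_nat k) b0).
        change (qpoch b q (S k)) with (qpoch b q k * (1 - b * pow_n q k)).
        change (@pow_n C_Ring q k) with (q ^ k). rewrite <- zpow_nat.
        revert H1. zexpand b0. zexpand q0. intros H1. field. repeat split; auto. }
    rewrite (csum_ext _ (fun k => t r k + (- RtoC 1) * (s (S k) - s k))) by (intros; rewrite E; ring).
    rewrite csum_plus, csum_scal, csum_telescope.
    rewrite (csum_extend (t r) (S r) (S (S r))), IH; [|lia|].
    + unfold s at 1. unfold t. rewrite binv_gt by lia. simpl s. unfold Cdiv. ring.
    + intros i Hi. unfold t. rewrite binv_gt by lia. unfold Cdiv. ring.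
Qed.

Lemma qpoch_zpow (q : C) (r k : nat) : (Cmod q < 1)%R -> q <> 0 ->
  qpoch (zpow q (Z.of_nat (S r))) q k = qp q (r + k) / qp q r.
Proof.
  intros hq q0. induction k as [|k IH].
  - rewrite Nat.add_0_r. simpl. field. now apply qp_nz.
  - rewrite Nat.add_succ_r, qp_S. cbn [qpoch]. rewrite IH.
    change (@pow_n C_Ring q k) with (q ^ k). rewrite <- zpow_nat, <- zpow_add by assumption.
    replace (Z.of_nat (S r) + Z.of_nat k)%Z with (Z.of_nat (S (r + k))) by lia.
    field. now apply qp_nz.
Qed.

(** The case [b = q^{r+1}] of [q_binomial_sum]. It evaluates every sum from which the factor
    [1 - p^{2k+1}] or [1 - q^{2k+1}] has cancelled. *)
Lemma sum_qp_ratio (q : C) (r : nat) : (Cmod q < 1)%R -> q <> 0 ->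
  csum (fun k => qp q (r + k) * zpow q (- (Z.of_nat (S r) * Z.of_nat k)) * binv q r k / qp q k) (S r)
  = zpow q (- (Z.of_nat r * Z.of_nat (S r))).
Proof.
  intros hq q0.
  assert (H0 := zpow_nz q (Z.of_nat (S r)) q0).
  rewrite <- (Cmult_1_r (zpow q _)), <- (q_binomial_sum q _ r hq q0 H0), <- csum_scal.
  apply csum_ext. intros k Hk. rewrite qpoch_zpow, zpow_zpow by assumption.
  replace (- (Z.of_nat (S r) * Z.of_nat k))%Z
    with (- (Z.of_nat r * Z.of_nat (S r)) + Z.of_nat (S r) * (Z.of_nat r - Z.of_nat k))%Z by ring.
  rewrite zpow_add by assumption. field. split; now apply qp_nz.
Qed.

(** Only the factor [1 - p^{2k+1}] is not a function of [p * p], so changing the sign of [p] acts on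
    that factor alone. *)
Definition bailey_f (p : C) (d r : nat) : C :=
  csum (fun k => qp (p * p) (r + k + d) * zpow (p * p) (- (Z.of_nat (r + d) * Z.of_nat k))
                 * binv (p * p) r k
                 / (qp (p * p) k * (1 - zpow p (2 * Z.of_nat k + 1)))) (S r).

Definition tri (n : nat) : Z := Z.of_nat (binom2 (S n)).

Lemma binom2_S (n : nat) : binom2 (S n) = (binom2 n + n)%nat.
Proof.
  unfold binom2. replace (S n * (S n - 1))%nat with (n * (n - 1) + n * 2)%nat by nia.
  now rewrite Nat.div_add by lia.
Qed.

Lemma tri_S (n : nat) : tri (S n) = (tri n + Z.of_nat (S n))%Z.
Proof. unfold tri. rewrite (binom2_S (S n)). lia. Qed.

Lemma tri_double (n : nat) : (2 * tri n = Z.of_nat n * Z.of_nat (S n))%Z.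
Proof.
  induction n as [|n IH]; [reflexivity|]. rewrite tri_S, Z.mul_add_distr_l, IH. lia.
Qed.

Lemma Cmod_sqr_lt_1 (p : C) : (Cmod p < 1)%R -> (Cmod (p * p) < 1)%R.
Proof. intros H. rewrite Cmod_mult. assert (H0 := Cmod_ge_0 p). nra. Qed.

Lemma zpow_sqr (p : C) (a : Z) : p <> 0 -> zpow (p * p) a = zpow p (2 * a).
Proof.
  intros hp. rewrite <- zpow_zpow by assumption. f_equal.
  change 2%Z with (1 + 1)%Z. now rewrite zpow_add, zpow_1 by assumption.
Qed.

(** With [q = p^2], the [k]-th terms are compared through [p^{-r-1} q^{-k} (1-q^{r+k+1}) - p^{-r}
    (1-p^{2r+1}) = p^{-r-1-2k} (1-p^{2k+1})]. The last factor cancels the denominator, and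
    [sum_qp_ratio] evaluates the rest. *)
Lemma bailey_f_step_even (p : C) (r : nat) : (Cmod p < 1)%R -> p <> 0 ->
  zpow p (- Z.of_nat (S r)) * bailey_f p 1 r
  = zpow p (- Z.of_nat r) * (1 - zpow p (2 * Z.of_nat r + 1)) * bailey_f p 0 r
    + zpow p (- tri (2 * r + 1)).
Proof.
  intros h p0. assert (hq := Cmod_sqr_lt_1 p h).
  assert (q0 : p * p <> 0) by (now apply Cmult_neq_0).
  replace (zpow p (- tri (2 * r + 1)))
    with (zpow p (- Z.of_nat (S r)) * zpow (p * p) (- (Z.of_nat r * Z.of_nat (S r)))).
  2:{ rewrite zpow_sqr, <- zpow_add by assumption. f_equal.
      assert (H := tri_double (2 * r + 1)). nia. }
  rewrite <- sum_qp_ratio by assumption. unfold bailey_f.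
  rewrite <- !csum_scal, <- csum_plus. apply csum_ext. intros k Hk.
  rewrite Nat.add_1_r, !Nat.add_0_r, Nat.add_1_r, qp_S.
  assert (H1 := one_minus_zpow_nz p (2 * Z.of_nat k + 1) h ltac:(lia)).
  assert (H2 := qp_nz _ k hq). assert (H3 := zpow_nz p (Z.of_nat r) p0).
  assert (H4 := zpow_nz p (Z.of_nat k) p0).
  assert (H5 := zpow_nz p (Z.of_nat r * Z.of_nat k) p0).
  revert H1. rewrite !zpow_sqr by assumption. zexpand p0. intros H1. field. repeat split; auto.
Qed.

(** Same cancellation, now from [(1-p^{2r+3}) - (1-p^{2r+2-2k}) = p^{2r+2-2k} (1-p^{2k+1})]; the
    shorter sum is first extended by a zero term at [k = r+1]. *)
Lemma bailey_f_step_odd (p : C) (r : nat) : (Cmod p < 1)%R -> p <> 0 ->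
  zpow p (- Z.of_nat (S r)) * (1 - zpow p (2 * Z.of_nat (S r) + 1)) * bailey_f p 0 (S r)
  = zpow p (- Z.of_nat (S r)) * bailey_f p 1 r + zpow p (- tri (2 * r + 2)).
Proof.
  intros h p0. assert (hq := Cmod_sqr_lt_1 p h).
  assert (q0 : p * p <> 0) by (now apply Cmult_neq_0).
  replace (zpow p (- tri (2 * r + 2)))
    with (zpow p (Z.of_nat (S r)) * zpow (p * p) (- (Z.of_nat (S r) * Z.of_nat (S (S r))))).
  2:{ rewrite zpow_sqr, <- zpow_add by assumption. f_equal.
      assert (H := tri_double (2 * r + 2)). nia. }
  rewrite <- sum_qp_ratio by assumption. unfold bailey_f.
  rewrite <- (csum_extend _ (S r) (S (S r))); [|lia|].
  2:{ intros i Hi. rewrite binv_gt by lia. unfold Cdiv. ring. }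
  rewrite <- !csum_scal, <- csum_plus. apply csum_ext. intros k Hk.
  rewrite (binv_succ_l _ r k), !Nat.add_0_r, !Nat.add_1_r by assumption.
  change (S r + k)%nat with (S (r + k)).
  assert (H1 := one_minus_zpow_nz p (2 * Z.of_nat k + 1) h ltac:(lia)).
  assert (H2 := qp_nz _ k hq). assert (H3 := zpow_nz p (Z.of_nat r) p0).
  assert (H4 := zpow_nz p (Z.of_nat k) p0).
  assert (H5 := zpow_nz p (Z.of_nat r * Z.of_nat k) p0).
  revert H1. rewrite !zpow_sqr by assumption. zexpand p0. intros H1. field. repeat split; auto.
Qed.

Lemma bailey_f_closed (p : C) (r : nat) : (Cmod p < 1)%R -> p <> 0 ->
  zpow p (- Z.of_nat r) * (1 - zpow p (2 * Z.of_nat r + 1)) * bailey_f p 0 r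
    = csum (fun i => zpow p (- tri i)) (2 * r + 1)
  /\ zpow p (- Z.of_nat (S r)) * bailey_f p 1 r
    = csum (fun i => zpow p (- tri i)) (2 * r + 2).
Proof.
  intros h p0.
  assert (A : forall r, zpow p (- Z.of_nat r) * (1 - zpow p (2 * Z.of_nat r + 1)) * bailey_f p 0 r
    = csum (fun i => zpow p (- tri i)) (2 * r + 1) ->
    zpow p (- Z.of_nat (S r)) * bailey_f p 1 r = csum (fun i => zpow p (- tri i)) (2 * r + 2)).
  { intros s E. rewrite bailey_f_step_even, E by assumption.
    replace (2 * s + 2)%nat with (S (2 * s + 1)) by lia. reflexivity. }
  cut (zpow p (- Z.of_nat r) * (1 - zpow p (2 * Z.of_nat r + 1)) * bailey_f p 0 r
    = csum (fun i => zpow p (- tri i)) (2 * r + 1)); [now auto|].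
  induction r as [|r IH].
  - unfold bailey_f. simpl. rewrite binv_le by lia. change (tri 0) with 0%Z.
    simpl. unfold qp. simpl. assert (H := one_minus_zpow_nz p 1 h ltac:(lia)).
    rewrite !zpow_0. field. auto.
  - rewrite bailey_f_step_odd, (A _ IH) by assumption.
    replace (2 * S r + 1)%nat with (S (2 * r + 2)) by lia. reflexivity.
Qed.

(** * Bailey inversion *)

Lemma sgn_S (n : nat) : sgn (S n) = - sgn n.
Proof.
  change (sgn (S n)) with (RtoC (-1) * sgn n). replace (RtoC (-1)) with (- RtoC 1) by (rewrite <- RtoC_opp; reflexivity). ring.
Qed.

Lemma sgn_add (m n : nat) : sgn (m + n) = sgn m * sgn n.
Proof.
  induction m as [|m IH].
  - change (sgn 0) with (RtoC 1). rewrite Nat.add_0_l. ring.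
  - rewrite Nat.add_succ_l, !sgn_S, IH. ring.
Qed.

Lemma sgn_sqr (n : nat) : sgn n * sgn n = 1.
Proof.
  induction n as [|n IH]; [change (RtoC 1 * RtoC 1 = 1); ring|].
  rewrite sgn_S. rewrite <- IH. ring.
Qed.

Lemma Cmod_sgn (n : nat) : Cmod (sgn n) = 1%R.
Proof.
  induction n as [|n IH]; [apply Cmod_1|]. now rewrite sgn_S, Cmod_opp.
Qed.

(** For fixed [k], [bailey_A] is, up to a constant, the alpha side of the Bailey pair relative to
    [a = q^{d+1}] with beta side [1/(q)_{n-k}]. Without the factor [1 - q^{2r+d+1}] the sequence has
    a simpler ratio in [r], so [bailey_D] is kept apart. *)
Definition bailey_D (q : C) (d r k : nat) : C :=
  sgn (r + k)
  * zpow q (2 * (Z.of_nat r * Z.of_nat r) + Z.of_nat r * Z.of_nat d + Z.of_nat r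
            - tri r - Z.of_nat r * Z.of_nat k - Z.of_nat k * Z.of_nat d - tri k)
  * qp q (r + k + d) * binv q r k.

Definition bailey_A (q : C) (d r k : nat) : C :=
  (1 - zpow q (2 * Z.of_nat r + Z.of_nat d + 1)) * bailey_D q d r k.

(** Stated without division so that it also covers [k = r + 1], where both sides vanish; the left
    side is the combination occurring in the certificate below. *)
Lemma bailey_D_step (q : C) (d r k : nat) : (Cmod q < 1)%R -> q <> 0 ->
  - bailey_D q d (S r) k * zpow q (- Z.of_nat (S r)) * (1 - zpow q (Z.of_nat (S r) - Z.of_nat k))
  = bailey_D q d r k * zpow q (2 * Z.of_nat r + Z.of_nat d + 1 - Z.of_nat k)
    * (1 - zpow q (Z.of_nat r + Z.of_nat k + Z.of_nat d + 1)).
Proof.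
  intros hq q0. unfold bailey_D. rewrite (binv_succ_l q r k) by assumption.
  change (S r + k)%nat with (S (r + k)). change (S (r + k) + d)%nat with (S (r + k + d)).
  rewrite sgn_S, qp_S, tri_S.
  assert (H1 := zpow_nz q (Z.of_nat r) q0). assert (H2 := zpow_nz q (Z.of_nat k) q0).
  assert (H3 := zpow_nz q (Z.of_nat d) q0). assert (H4 := zpow_nz q (tri r) q0).
  assert (H5 := zpow_nz q (Z.of_nat r * Z.of_nat k) q0).
  assert (H6 := zpow_nz q (Z.of_nat k * Z.of_nat d) q0).
  assert (H7 := zpow_nz q (tri k) q0).
  zexpand q0. field. repeat split; auto.
Qed.

(* Creative telescoping in n. *)
Lemma bailey_inversion_step (q : C) (d n r k : nat) : (Cmod q < 1)%R -> q <> 0 ->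
  let H := fun r => - zpow q (Z.of_nat (S n)) * bailey_D q d r k * zpow q (- Z.of_nat r)
     * (1 - zpow q (Z.of_nat r - Z.of_nat k)) * binv q (S n) r / qp q (S (n + r + d)) in
  (1 - zpow q (Z.of_nat (S n) - Z.of_nat k))
    * (bailey_A q d r k * binv q (S n) r / qp q (S (S n + r + d)))
  = bailey_A q d r k * binv q n r / qp q (S (n + r + d)) + (H (S r) - H r).
Proof.
  intros hq q0 H.
  (* Expressing [H (S r)] through [bailey_D q d r k] gives all terms that common factor. *)
  assert (E : H (S r) = zpow q (Z.of_nat (S n)) *
    (bailey_D q d r k * zpow q (2 * Z.of_nat r + Z.of_nat d + 1 - Z.of_nat k)
    * (1 - zpow q (Z.of_nat r + Z.of_nat k + Z.of_nat d + 1)))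
    * binv q (S n) (S r) / qp q (S (n + S r + d))).
  { unfold H. rewrite <- bailey_D_step by assumption. unfold Cdiv. ring. }
  rewrite E. unfold H, bailey_A.
  replace (n + S r + d)%nat with (S (n + r + d)) by lia.
  change (S n + r + d)%nat with (S (n + r + d)).
  rewrite binv_SS, (binv_succ_l q n r), (qp_S _ (S (n + r + d))) by assumption.
  assert (H0 := qp_nz q (S (n + r + d)) hq).
  assert (H1 := zpow_nz q (Z.of_nat r) q0). assert (H2 := zpow_nz q (Z.of_nat k) q0).
  assert (H3 := one_minus_zpow_nz q (Z.of_nat (S (S (n + r + d)))) hq ltac:(lia)).
  revert H0 H3. generalize (qp q (S (n + r + d))). intros P.
  zexpand q0. intros H0 H3. field. repeat split; auto.
Qed.

Lemma bailey_D_gt (q : C) (d r k : nat) : (r < k)%nat -> bailey_D q d r k = 0.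
Proof. intros. unfold bailey_D. rewrite binv_gt by assumption. ring. Qed.

Lemma bailey_A_gt (q : C) (d r k : nat) : (r < k)%nat -> bailey_A q d r k = 0.
Proof. intros. unfold bailey_A. rewrite bailey_D_gt by assumption. ring. Qed.

Lemma bailey_A_diag (q : C) (d k : nat) : (Cmod q < 1)%R -> q <> 0 ->
  bailey_A q d k k / qp q (S (k + k + d)) = 1.
Proof.
  intros hq q0. unfold bailey_A, bailey_D.
  rewrite sgn_add, sgn_sqr, binv_le, Nat.sub_diag, qp_S by lia.
  change (qp q 0) with (RtoC 1).
  replace (_ - tri k)%Z with 0%Z by (assert (H := tri_double k); nia).
  replace (2 * Z.of_nat k + Z.of_nat d + 1)%Z with (Z.of_nat (S (k + k + d))) by lia.
  rewrite zpow_0. field. split; [|now apply qp_nz].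
  apply one_minus_zpow_nz; [assumption|lia].
Qed.

Lemma Cmult_cancel_l (x a b : C) : x <> 0 -> x * a = x * b -> a = b.
Proof.
  intros hx H. replace a with (x * a / x) by (field; assumption). rewrite H. field. assumption.
Qed.

(** Both sides satisfy the same first-order recurrence in [n]. Its leading coefficient
    [1 - q^{n+1-k}] vanishes at [n + 1 = k], so the range [n <= k] is settled directly: by
    triangularity at most the term [r = k] survives there. *)
Lemma bailey_inversion (q : C) (d n k : nat) : (Cmod q < 1)%R -> q <> 0 ->
  binv q n k = csum (fun r => bailey_A q d r k * binv q n r / qp q (S (n + r + d))) (S n).
Proof.
  intros hq q0.
  assert (D : forall n, (n <= k)%nat -> binv q n k =
    csum (fun r => bailey_A q d r k * binv q n r / qp q (S (n + r + d))) (S n)).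
  { intros m Hm. simpl csum. rewrite csum_zero.
    2:{ intros i Hi. rewrite bailey_A_gt by lia. unfold Cdiv. ring. }
    destruct (Nat.eq_dec m k) as [->|H].
    - rewrite !binv_le, Nat.sub_diag by lia. change (qp q 0) with (RtoC 1).
      transitivity (bailey_A q d k k / qp q (S (k + k + d))); [|unfold Cdiv; field].
      + rewrite bailey_A_diag by assumption. field.
      + now apply qp_nz.
    - rewrite bailey_A_gt, binv_gt by lia. unfold Cdiv. ring. }
  induction n as [|n IH]; [apply D; lia|].
  destruct (le_lt_dec (S n) k) as [H|H]; [apply D; assumption|].
  assert (H1 := one_minus_zpow_nz q (Z.of_nat (S n) - Z.of_nat k) hq ltac:(lia)).
  set (x := 1 - _) in H1.
  assert (E : x * binv q (S n) k = x *
    csum (fun r => bailey_A q d r k * binv q (S n) r / qp q (S (S n + r + d))) (S (S n))).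
  2:{ now apply (Cmult_cancel_l x). }
  unfold x. rewrite <- binv_succ_l, <- csum_scal by assumption.
  set (G := fun r => - zpow q (Z.of_nat (S n)) * bailey_D q d r k * zpow q (- Z.of_nat r)
     * (1 - zpow q (Z.of_nat r - Z.of_nat k)) * binv q (S n) r / qp q (S (n + r + d))).
  rewrite (csum_ext _ (fun r => bailey_A q d r k * binv q n r / qp q (S (n + r + d))
    + (G (S r) - G r))) by (intros; now apply bailey_inversion_step).
  rewrite csum_plus, csum_telescope. unfold G. rewrite (csum_extend _ (S n) (S (S n))); [|lia|].
  2:{ intros i Hi. rewrite binv_gt by lia. unfold Cdiv. ring. }
  rewrite IH, (binv_gt _ (S n) (S (S n))) by lia.
  (* The lower boundary term [G 0] vanishes: for [k = 0] by its factor [1 - q^0], otherwise because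
     [bailey_D q d 0 k = 0]. *)
  destruct k as [|k].
  - rewrite Z.sub_diag, !zpow_0. unfold Cdiv. ring.
  - rewrite (bailey_D_gt q d 0) by lia. unfold Cdiv. ring.
Qed.

(** * The conjugate Bailey pair *)

(** The part of the L summands that depends on [n] alone, after an index shift by one when
    [d = 1]. *)
Definition bailey_delta (q : C) (d n : nat) : C :=
  qp q n * sgn n * zpow q (tri n + Z.of_nat n * Z.of_nat d).

Definition conj_sum (q : C) (d N r : nat) : C :=
  csum (fun n => bailey_delta q d n * binv q n r / qp q (S (n + r + d))) (S N).

Definition conj_lim (q : C) (d r : nat) : C :=
  sgn r * zpow q (tri r + Z.of_nat r * Z.of_nat d) * qp q r / qp q (r + d).

(** Telescoping in [n] with certificate [G]. The right side is the boundary value at [n = N+1], the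
    only trace of the truncation; [conj_lim] satisfies the recurrence without it. *)
Lemma conj_sum_rec (q : C) (d N r : nat) : (Cmod q < 1)%R -> q <> 0 ->
  (1 - zpow q (Z.of_nat (S r) + Z.of_nat d)) * conj_sum q d N (S r)
  + zpow q (Z.of_nat (S r) + Z.of_nat d) * (1 - zpow q (Z.of_nat (S r))) * conj_sum q d N r
  = - bailey_delta q d (S N) * (1 - zpow q (2 * Z.of_nat (S r) + Z.of_nat d))
    * binv q (S N) (S r) / qp q (S (S N + r + d)).
Proof.
  intros hq q0.
  set (G := fun n => - bailey_delta q d n * (1 - zpow q (2 * Z.of_nat (S r) + Z.of_nat d))
    * binv q n (S r) / qp q (S (n + r + d))).
  transitivity (csum (fun n => G (S n) - G n) (S N)).
  2:{ rewrite csum_telescope. unfold G. rewrite (binv_gt _ 0) by lia. unfold Cdiv. ring. }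
  unfold conj_sum. rewrite <- !csum_scal, <- csum_plus. apply csum_ext. intros n Hn.
  unfold G, bailey_delta. rewrite binv_SS, (binv_succ_r q n r), (tri_S n) by assumption.
  replace (n + S r + d)%nat with (S (n + r + d)) by lia.
  change (S n + r + d)%nat with (S (n + r + d)).
  rewrite (qp_S _ (S (n + r + d))), (qp_S _ n), sgn_S.
  assert (H0 := qp_nz q (S (n + r + d)) hq).
  assert (H1 := zpow_nz q (Z.of_nat r) q0).
  assert (H3 := one_minus_zpow_nz q (Z.of_nat (S (S (n + r + d)))) hq ltac:(lia)).
  revert H0 H3. generalize (qp q (S (n + r + d))). intros P.
  zexpand q0. intros H0 H3. field. repeat split; auto.
Qed.

Lemma conj_lim_rec (q : C) (d r : nat) : (Cmod q < 1)%R -> q <> 0 ->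
  (1 - zpow q (Z.of_nat (S r) + Z.of_nat d)) * conj_lim q d (S r)
  + zpow q (Z.of_nat (S r) + Z.of_nat d) * (1 - zpow q (Z.of_nat (S r))) * conj_lim q d r = 0.
Proof.
  intros hq q0. unfold conj_lim. rewrite sgn_S, tri_S.
  change (S r + d)%nat with (S (r + d)). rewrite !qp_S.
  assert (H0 := qp_nz q (r + d) hq).
  assert (H3 := one_minus_zpow_nz q (Z.of_nat (S (r + d))) hq ltac:(lia)).
  revert H3. zexpand q0. intros H3. field. auto.
Qed.

(** For [r = 0] the factors [(q)_n] cancel and the truncation error is known exactly, by induction
    on [N]; it starts the estimate in [r]. *)
Lemma conj_sum_0 (q : C) (d N : nat) : (Cmod q < 1)%R -> q <> 0 ->
  conj_sum q d N 0 - conj_lim q d 0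
  = sgn N * zpow q (tri (S N) + Z.of_nat (S N) * Z.of_nat d) / qp q (S N + d).
Proof.
  intros hq q0. unfold conj_sum, conj_lim. change (sgn 0) with (RtoC 1).
  change (tri 0) with 0%Z. simpl (Z.of_nat 0). rewrite Z.mul_0_l. change (zpow q (0 + 0)) with (RtoC 1).
  change (0 + d)%nat with d. change (qp q 0) with (RtoC 1).
  assert (E : forall n, bailey_delta q d n * binv q n 0 / qp q (S (n + 0 + d))
    = sgn n * zpow q (tri n + Z.of_nat n * Z.of_nat d) / qp q (S (n + d))).
  { intros n. rewrite binv_le, Nat.sub_0_r, Nat.add_0_r by lia. unfold bailey_delta.
    field. split; now apply qp_nz. }
  erewrite csum_ext by (intros; apply E). clear E.
  induction N as [|N IH].
  - simpl csum. change (sgn 0) with (RtoC 1). change (tri 1) with 1%Z. change (tri 0) with 0%Z.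
    simpl (Z.of_nat 0). change (S 0 + d)%nat with (S d). change (0 + d)%nat with d. rewrite qp_S.
    assert (H0 := qp_nz q d hq).
    assert (H3 := one_minus_zpow_nz q (Z.of_nat (S d)) hq ltac:(lia)).
    revert H3. rewrite ?Z.mul_0_l. zexpand q0. intros H3. simpl (Z.of_nat 0). rewrite ?zpow_0. field. auto.
  - remember (S N) as M. simpl csum.
    match goal with |- ?a + ?b - ?c = _ => replace (a + b - c) with ((a - c) + b) by ring end.
    rewrite IH. subst M. rewrite (tri_S (S N)), sgn_S.
    change (S (S N) + d)%nat with (S (S N + d)). rewrite (qp_S _ (S N + d)).
    assert (H0 := qp_nz q (S N + d) hq).
    assert (H3 := one_minus_zpow_nz q (Z.of_nat (S (S N + d))) hq ltac:(lia)).
    revert H0 H3. generalize (qp q (S N + d)). intros P.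
    zexpand q0. intros H0 H3. field. auto.
Qed.

Definition bailey_sum (q : C) (d : nat) (c : nat -> C) (r : nat) : C :=
  csum (fun k => c k * bailey_A q d r k) (S r).

(** The Bailey transform before any limit: after inserting [bailey_inversion], all ranges are padded
    with zeros to [0..N], where the sums commute. *)
Lemma bailey_transform (q : C) (d N : nat) (c : nat -> C) : (Cmod q < 1)%R -> q <> 0 ->
  csum (fun n => bailey_delta q d n * csum (fun k => c k * binv q n k) (S n)) (S N)
  = csum (fun r => bailey_sum q d c r * conj_sum q d N r) (S N).
Proof.
  intros hq q0.
  set (t := fun n r k => bailey_delta q d n * c k * bailey_A q d r k * binv q n r / qp q (S (n + r + d))).
  transitivity (csum (fun n => csum (fun r => csum (t n r) (S N)) (S N)) (S N)).
  - apply csum_ext. intros n Hn. rewrite csum_swap.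
    rewrite <- (csum_extend _ (S n) (S N)) by (lia || (intros; rewrite binv_gt by lia; ring)).
    rewrite <- csum_scal. apply csum_ext. intros k Hk.
    rewrite (bailey_inversion q d n k) at 1 by assumption.
    rewrite <- (csum_extend _ (S n) (S N)); [|lia|].
    + rewrite Cmult_assoc, <- csum_scal. apply csum_ext. intros r Hr. unfold t, Cdiv. ring.
    + intros i Hi. rewrite binv_gt by lia. unfold Cdiv. ring.
  - rewrite csum_swap. apply csum_ext. intros r Hr. unfold conj_sum, bailey_sum.
    rewrite <- csum_scal. apply csum_ext. intros n Hn.
    rewrite (csum_extend (t n r) (S r) (S N)); [|lia|].
    + rewrite (Cmult_comm (csum _ _)), <- csum_scal. apply csum_ext. intros k Hk. unfold t, Cdiv. ring.
    + intros k Hk. unfold t. rewrite bailey_A_gt by lia. unfold Cdiv. ring.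
Qed.

(** * Passing to the limit *)

(** One constant dominating both [|1 - q^a| <= 2] and [|1/(1 - q^a)| <= 1/(1-|q|)], so that [(q)_n]
    and its inverse are both at most [qbound q ^ n]. *)
Definition qbound (q : C) : R := (2 / (1 - Cmod q))%R.

Lemma qbound_ge_2 (q : C) : (Cmod q < 1)%R -> (2 <= qbound q)%R.
Proof.
  intros hq. unfold qbound. assert (H := Cmod_ge_0 q).
  apply Rmult_le_reg_r with (1 - Cmod q)%R; [lra|]. field_simplify; lra.
Qed.

Lemma Cmod_mult_le (x y : C) (a b : R) :
  (Cmod x <= a)%R -> (Cmod y <= b)%R -> (Cmod (x * y) <= a * b)%R.
Proof.
  intros Hx Hy. rewrite Cmod_mult. apply Rmult_le_compat; auto using Cmod_ge_0.
Qed.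

Lemma Cmod_one_minus_zpow (q : C) (a : Z) : (Cmod q < 1)%R -> (0 <= a)%Z ->
  (Cmod (1 - zpow q a) <= qbound q)%R.
Proof.
  intros hq ha. apply Rle_trans with 2%R; [|now apply qbound_ge_2].
  eapply Rle_trans; [apply Cmod_triangle|]. rewrite Cmod_opp, Cmod_1.
  assert (H := Cmod_zpow_le_1 q a ltac:(lra) ha). lra.
Qed.

Lemma Cmod_inv_one_minus_zpow (q : C) (a : Z) : (Cmod q < 1)%R -> (0 < a)%Z ->
  (Cmod (/ (1 - zpow q a)) <= qbound q)%R.
Proof.
  intros hq ha. rewrite Cmod_inv by now apply one_minus_zpow_nz.
  assert (H : (1 - Cmod q <= Cmod (1 - zpow q a))%R).
  { assert (H1 : (Cmod (zpow q a) <= Cmod q)%R).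
    { replace a with (Z.of_nat (S (Z.to_nat (a - 1)))) by lia.
      rewrite zpow_nat, Cmod_pow, <- tech_pow_Rmult.
      assert (H2 : (Cmod q ^ Z.to_nat (a - 1) <= 1)%R).
      { rewrite <- (pow1 (Z.to_nat (a - 1))). apply pow_incr.
        split; [apply Cmod_ge_0|lra]. }
      assert (H3 := Cmod_ge_0 q). nra. }
    assert (H2 := Cmod_triangle (1 - zpow q a) (zpow q a)).
    replace (1 - zpow q a + zpow q a) with (RtoC 1) in H2 by ring.
    rewrite Cmod_1 in H2. lra. }
  apply Rle_trans with (/ (1 - Cmod q))%R.
  - apply Rinv_le_contravar; lra.
  - unfold qbound, Rdiv. assert (0 < / (1 - Cmod q))%R by (apply Rinv_0_lt_compat; lra). lra.
Qed.

Lemma Cmod_qp (q : C) (n : nat) : (Cmod q < 1)%R -> (Cmod (qp q n) <= qbound q ^ n)%R.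
Proof.
  intros hq. induction n as [|n IH].
  - change (qp q 0) with (RtoC 1). rewrite Cmod_1. simpl. lra.
  - rewrite qp_S, <- tech_pow_Rmult, Rmult_comm. apply Cmod_mult_le; [assumption|].
    apply Cmod_one_minus_zpow; [assumption|lia].
Qed.

Lemma Cmod_inv_qp (q : C) (n : nat) : (Cmod q < 1)%R -> (Cmod (/ qp q n) <= qbound q ^ n)%R.
Proof.
  intros hq. induction n as [|n IH].
  - change (qp q 0) with (RtoC 1). rewrite Cmod_inv, Cmod_1 by exact C1_nz. simpl. lra.
  - assert (H1 := one_minus_zpow_nz q (Z.of_nat (S n)) hq ltac:(lia)).
    replace (/ qp q (S n)) with (/ qp q n * / (1 - zpow q (Z.of_nat (S n)))).
    + rewrite <- tech_pow_Rmult, Rmult_comm. apply Cmod_mult_le; [assumption|].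
      apply Cmod_inv_one_minus_zpow; [assumption|lia].
    + rewrite qp_S. field. split; [assumption|now apply qp_nz].
Qed.

Lemma qbound_pow_le (q : C) (m n : nat) : (Cmod q < 1)%R -> (m <= n)%nat ->
  (qbound q ^ m <= qbound q ^ n)%R.
Proof. intros hq H. apply Rle_pow; [|assumption]. assert (H1 := qbound_ge_2 q hq). lra. Qed.

Lemma Cmod_binv (q : C) (n k : nat) : (Cmod q < 1)%R -> (Cmod (binv q n k) <= qbound q ^ n)%R.
Proof.
  intros hq. destruct (le_lt_dec k n) as [H|H].
  - rewrite binv_le by assumption. eapply Rle_trans; [now apply Cmod_inv_qp|].
    apply qbound_pow_le; [assumption|lia].
  - rewrite binv_gt, Cmod_0 by assumption. apply pow_le.
    assert (H1 := qbound_ge_2 q hq). lra.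
Qed.

Lemma Cmod_zpow_tri (q : C) (n : nat) (a : Z) : (Cmod q < 1)%R -> q <> 0 -> (0 <= a)%Z ->
  (Cmod (zpow q (tri n + a)) <= Cmod q ^ binom2 (S n))%R.
Proof.
  intros hq q0 ha. rewrite zpow_add by assumption. unfold tri. rewrite zpow_nat.
  rewrite <- (Rmult_1_r (Cmod q ^ _)), <- Cmod_pow.
  apply Cmod_mult_le; [lra|]. apply Cmod_zpow_le_1; [lra|assumption].
Qed.

(** Subtracting the two recurrences bounds the error at [r+1] by that at [r] plus the boundary term.
    Each step costs at most three factors [qbound q], whence [3 * r]; the remaining exponent covers
    the boundary term. *)
Lemma conj_sum_error (q : C) (d N r : nat) : (Cmod q < 1)%R -> q <> 0 -> (r <= N)%nat ->
  (Cmod (conj_sum q d N r - conj_lim q d r)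
   <= Cmod q ^ binom2 (S (S N)) * qbound q ^ (4 * N + d + 5 + 3 * r))%R.
Proof.
  intros hq q0. assert (HB := qbound_ge_2 q hq).
  set (T := (Cmod q ^ binom2 (S (S N)))%R). assert (HT : (0 <= T)%R) by (apply pow_le, Cmod_ge_0).
  induction r as [|r IH]; intros Hr.
  - rewrite conj_sum_0 by assumption.
    replace (sgn N * _) with (zpow q (tri (S N) + Z.of_nat (S N) * Z.of_nat d) * sgn N) by ring.
    apply Rle_trans with (T * 1 * qbound q ^ (S N + d))%R.
    + apply Cmod_mult_le; [apply Cmod_mult_le|].
      * apply Cmod_zpow_tri; auto. lia.
      * rewrite Cmod_sgn. lra.
      * now apply Cmod_inv_qp.
    + rewrite Rmult_1_r. apply Rmult_le_compat_l; [assumption|].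
      apply qbound_pow_le; [assumption|lia].
  - specialize (IH ltac:(lia)).
    assert (H1 := conj_sum_rec q d N r hq q0). assert (H2 := conj_lim_rec q d r hq q0).
    set (b := - bailey_delta _ _ _ * _ * _ / _) in H1.
    set (u := 1 - zpow q (Z.of_nat (S r) + Z.of_nat d)) in *.
    assert (Hu : u <> 0) by (apply one_minus_zpow_nz; [assumption|lia]).
    replace (conj_sum q d N (S r) - conj_lim q d (S r)) with
      (/ u * (b - zpow q (Z.of_nat (S r) + Z.of_nat d) * ((1 - zpow q (Z.of_nat (S r)))
                  * (conj_sum q d N r - conj_lim q d r)))).
    2:{ apply (Cmult_cancel_l u); [assumption|]. rewrite <- H1.
        transitivity (u * conj_sum q d N (S r) + zpow q (Z.of_nat (S r) + Z.of_nat d)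
          * (1 - zpow q (Z.of_nat (S r))) * conj_lim q d r); [field; assumption|].
        transitivity (u * conj_sum q d N (S r) + zpow q (Z.of_nat (S r) + Z.of_nat d)
          * (1 - zpow q (Z.of_nat (S r))) * conj_lim q d r - 0); [ring|]. rewrite <- H2. ring. }
    assert (Hb : (Cmod b <= T * qbound q ^ (4 * N + d + 5))%R).
    { apply Rle_trans with (qbound q ^ (S N) * 1 * T * qbound q * qbound q ^ (S N)
         * qbound q ^ (S (S N + r + d)))%R.
      - unfold b. apply Cmod_mult_le; [|now apply Cmod_inv_qp].
        apply Cmod_mult_le; [|now apply Cmod_binv].
        apply Cmod_mult_le; [|apply Cmod_one_minus_zpow; [assumption|lia]].
        rewrite Cmod_opp. unfold bailey_delta.
        apply Cmod_mult_le; [|apply Cmod_zpow_tri; auto; lia].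
        apply Cmod_mult_le; [now apply Cmod_qp|]. rewrite Cmod_sgn. lra.
      - apply Rle_trans with (T * qbound q ^ (S N + 1 + S N + S (S N + r + d)))%R.
        + right. rewrite !pow_add, pow_1. ring.
        + apply Rmult_le_compat_l; [assumption|]. apply qbound_pow_le; [assumption|lia]. }
    set (M := (T * qbound q ^ (4 * N + d + 5))%R) in *.
    assert (HM : (0 <= M)%R) by (apply Rmult_le_pos; [assumption|apply pow_le; lra]).
    assert (E : forall s, (T * qbound q ^ (4 * N + d + 5 + s) = M * qbound q ^ s)%R)
      by (intros; rewrite pow_add; unfold M; ring).
    rewrite E in *.
    apply Rle_trans with (qbound q * (M + 1 * (qbound q * (M * qbound q ^ (3 * r)))))%R.
    + apply Cmod_mult_le; [apply Cmod_inv_one_minus_zpow; [assumption|lia]|].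
      eapply Rle_trans; [apply Cmod_triangle|]. rewrite Cmod_opp.
      apply Rplus_le_compat; [assumption|].
      apply Cmod_mult_le; [apply Cmod_zpow_le_1; [lra|lia]|].
      apply Cmod_mult_le; [apply Cmod_one_minus_zpow; [assumption|lia]|assumption].
    + replace (3 * S r)%nat with (3 * r + 3)%nat by lia. rewrite pow_add.
      assert (Hp : (1 <= qbound q ^ (3 * r))%R) by (apply pow_R1_Rle; lra).
      set (y := (qbound q ^ (3 * r))%R) in *. set (B := qbound q) in *.
      replace (M * (y * B ^ 3))%R with (B * (M * (B * B * y)))%R by ring.
      apply Rmult_le_compat_l; [lra|].
      replace (M + 1 * (B * (M * y)))%R with (M * (1 + B * y))%R by ring.
      apply Rmult_le_compat_l; [assumption|]. assert (1 <= B * y)%R by nra. nra.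
Qed.

(** The hypothesis allows [q^{tri k - k}] because L4 has [q^{k(k-1)/2}]. For [k <= r] this exponent
    plus that of [bailey_D] is still nonnegative, so only the q-factorials contribute to the
    bound. *)
Lemma Cmod_bailey_sum (q : C) (d : nat) (c : nat -> C) (r : nat) : (Cmod q < 1)%R -> q <> 0 ->
  (forall k, (Cmod (c k) <= qbound q ^ (k + 1) * Cmod (zpow q (tri k - Z.of_nat k)))%R) ->
  (Cmod (bailey_sum q d c r) <= INR (S r) * qbound q ^ (4 * r + d + 2))%R.
Proof.
  intros hq q0 hc. assert (HB := qbound_ge_2 q hq). apply Cmod_csum_le. intros k Hk.
  unfold bailey_A, bailey_D.
  set (e := (2 * (Z.of_nat r * Z.of_nat r) + Z.of_nat r * Z.of_nat d + Z.of_nat r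
            - tri r - Z.of_nat r * Z.of_nat k - Z.of_nat k * Z.of_nat d - tri k)%Z).
  assert (He : (Cmod (zpow q (tri k - Z.of_nat k)) * Cmod (zpow q e) <= 1)%R).
  { rewrite <- Cmod_mult, <- zpow_add by assumption. apply Cmod_zpow_le_1; [lra|].
    unfold e. assert (H1 := tri_double r). nia. }
  rewrite !Cmod_mult, Cmod_sgn.
  apply Rle_trans with (qbound q ^ (k + 1) * (qbound q * (qbound q ^ (r + k + d) * qbound q ^ r)))%R.
  2:{ rewrite <- !pow_add, tech_pow_Rmult, <- pow_add. apply qbound_pow_le; [assumption|lia]. }
  assert (H1 := Cmod_one_minus_zpow q (2 * Z.of_nat r + Z.of_nat d + 1) hq ltac:(lia)).
  assert (H2 := Cmod_qp q (r + k + d) hq). assert (H3 := Cmod_binv q r k hq).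
  set (a1 := Cmod (1 - _)) in *. set (a2 := Cmod (qp _ _)) in *. set (a3 := Cmod (binv _ _ _)) in *.
  assert (P1 : (0 <= a1)%R) by apply Cmod_ge_0. assert (P2 : (0 <= a2)%R) by apply Cmod_ge_0.
  assert (P3 : (0 <= a3)%R) by apply Cmod_ge_0. assert (P4 := Cmod_ge_0 (zpow q e)).
  assert (P5 : (0 <= qbound q ^ (k + 1))%R) by (apply pow_le; lra).
  apply Rle_trans with
    ((qbound q ^ (k + 1) * Cmod (zpow q (tri k - Z.of_nat k))) * (a1 * (1 * Cmod (zpow q e) * a2 * a3)))%R.
  - apply Rmult_le_compat_r; [|apply hc]. repeat apply Rmult_le_pos; auto. lra.
  - replace (qbound q ^ (k + 1) * Cmod (zpow q (tri k - Z.of_nat k)) * (a1 * (1 * Cmod (zpow q e) * a2 * a3)))%R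
      with ((Cmod (zpow q (tri k - Z.of_nat k)) * Cmod (zpow q e)) * (qbound q ^ (k + 1) * (a1 * (a2 * a3))))%R by ring.
    rewrite <- (Rmult_1_l (qbound q ^ (k + 1) * (qbound q * _))).
    apply Rmult_le_compat; auto.
    + apply Rmult_le_pos; apply Cmod_ge_0.
    + repeat apply Rmult_le_pos; auto.
    + repeat apply Rmult_le_compat; auto; try lra; repeat apply Rmult_le_pos; auto.
Qed.

(** Ratio test: consecutive terms have quotient [W rho^{n+1}], which tends to 0. *)
Lemma pow_mult_gauss_lim (W rho : R) : (0 < W)%R -> (0 < rho < 1)%R ->
  is_lim_seq (fun n => W ^ n * rho ^ binom2 (S n))%R 0%R.
Proof.
  intros hW hr. apply ex_series_lim_0.
  assert (Hpos : forall n, (0 < W ^ n * rho ^ binom2 (S n))%R).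
  { intros n. apply Rmult_lt_0_compat; apply pow_lt; lra. }
  apply (ex_series_ext (V := R_NormedModule)) with (fun n => W ^ n * rho ^ binom2 (S n))%R; [reflexivity|].
  apply ex_series_Rabs, ex_series_DAlembert with 0%R; [lra| |].
  - intros n. apply Rgt_not_eq, Hpos.
  - apply is_lim_seq_ext with (fun n => (W * rho) * rho ^ n)%R.
    + intros n. rewrite Rabs_pos_eq.
      * rewrite (binom2_S (S n)), pow_add. specialize (Hpos n). simpl pow. field.
        split; apply pow_nonzero; lra.
      * left. apply Rdiv_lt_0_compat; apply Hpos.
    + replace (Finite 0) with (Rbar_mult (W * rho)%R 0%R) by (simpl; f_equal; ring).
      apply is_lim_seq_scal_l. apply is_lim_seq_geom. rewrite Rabs_pos_eq; lra.
Qed.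

Definition Ccvg (u : nat -> C) (l : C) : Prop := is_lim_seq (fun n => Cmod (u n - l)) 0%R.

Lemma Ccvg_0_le (u : nat -> C) (b : nat -> R) :
  (forall n, (Cmod (u n) <= b n)%R) -> is_lim_seq b 0%R -> Ccvg u 0.
Proof.
  intros H Hb. apply is_lim_seq_le_le with (fun _ => 0%R) b.
  - intros n. replace (u n - 0) with (u n) by ring. split; [apply Cmod_ge_0|apply H].
  - apply is_lim_seq_const.
  - exact Hb.
Qed.

(** Stated for the difference, since neither side is yet known to converge. *)
Lemma bailey_limit (q : C) (d : nat) (c : nat -> C) : (Cmod q < 1)%R -> q <> 0 ->
  (forall k, (Cmod (c k) <= qbound q ^ (k + 1) * Cmod (zpow q (tri k - Z.of_nat k)))%R) ->
  Ccvg (fun N => csum (fun n => bailey_delta q d n * csum (fun k => c k * binv q n k) (S n)) (S N)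
                 - csum (fun r => bailey_sum q d c r * conj_lim q d r) (S N)) 0.
Proof.
  intros hq q0 hc. assert (HB := qbound_ge_2 q hq).
  assert (Hq : (0 < Cmod q)%R) by (now apply Cmod_gt_0).
  (* The bounds below collect the exponent [13 N + 2 d + 7], two factors [N + 1] being absorbed by
     [qbound q ^ N]; this is at most [(20 + 2 d)(N + 1)]. *)
  apply Ccvg_0_le with (fun N => (qbound q ^ (20 + 2 * d)) ^ (S N) * Cmod q ^ binom2 (S (S N)))%R.
  2:{ apply (is_lim_seq_incr_1 (fun n => (qbound q ^ (20 + 2 * d)) ^ n * Cmod q ^ binom2 (S n))%R).
      apply pow_mult_gauss_lim; [apply pow_lt; lra|lra]. }
  intros N. rewrite bailey_transform by assumption.
  assert (E : csum (fun r => bailey_sum q d c r * conj_sum q d N r) (S N)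
    - csum (fun r => bailey_sum q d c r * conj_lim q d r) (S N)
    = csum (fun r => bailey_sum q d c r * (conj_sum q d N r - conj_lim q d r)) (S N)).
  { rewrite (csum_ext (fun r => _ * (_ - _)) (fun r => bailey_sum q d c r * conj_sum q d N r
      + (- RtoC 1) * (bailey_sum q d c r * conj_lim q d r))) by (intros; ring).
    rewrite csum_plus, csum_scal. ring. }
  rewrite E. clear E.
  set (T := (Cmod q ^ binom2 (S (S N)))%R). assert (HT : (0 <= T)%R) by (apply pow_le, Cmod_ge_0).
  assert (HN : (INR (S N) <= qbound q ^ N)%R).
  { apply Rle_trans with (2 ^ N)%R; [|apply pow_incr; lra].
    clear. induction N as [|N IH]; [simpl; lra|]. rewrite S_INR.
    assert (1 <= 2 ^ N)%R by (apply pow_R1_Rle; lra). simpl pow. lra. }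
  apply Rle_trans with (INR (S N) * (INR (S N) * qbound q ^ (4 * N + d + 2)
     * (T * qbound q ^ (4 * N + d + 5 + 3 * N))))%R.
  - apply Cmod_csum_le. intros r Hr. apply Cmod_mult_le.
    + eapply Rle_trans; [now apply Cmod_bailey_sum|]. apply Rmult_le_compat.
      * apply pos_INR.
      * apply pow_le; lra.
      * apply le_INR. lia.
      * apply qbound_pow_le; [assumption|lia].
    + eapply Rle_trans; [apply conj_sum_error; auto; lia|].
      apply Rmult_le_compat_l; [assumption|]. apply qbound_pow_le; [assumption|lia].
  - assert (P0 := pos_INR (S N)).
    apply Rle_trans with (qbound q ^ N * (qbound q ^ N * qbound q ^ (4 * N + d + 2)
     * (T * qbound q ^ (4 * N + d + 5 + 3 * N))))%R.
    + assert (P1 : forall n, (0 <= qbound q ^ n)%R) by (intros; apply pow_le; lra).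
      apply Rmult_le_compat; auto; [repeat apply Rmult_le_pos; auto|].
      apply Rmult_le_compat_r; [apply Rmult_le_pos; auto|].
      apply Rmult_le_compat_r; auto.
    + apply Rle_trans with (qbound q ^ (N + (N + (4 * N + d + 2) + (4 * N + d + 5 + 3 * N))) * T)%R.
      * right. rewrite !pow_add. ring.
      * apply Rmult_le_compat_r; [assumption|]. rewrite <- pow_mult.
        apply qbound_pow_le; [assumption|nia].
Qed.

(** * Hecke-type sums *)

(** Signs and triangular exponents of the coefficient, of [bailey_D] and of [conj_lim] cancel,
    leaving a sum of the shape of [bailey_f]. *)
Lemma bailey_term (q : C) (d : nat) (e : nat -> C) (r : nat) : (Cmod q < 1)%R -> q <> 0 ->
  bailey_sum q d (fun k => sgn k * zpow q (tri k) * e k) r * conj_lim q d r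
  = (1 - zpow q (2 * Z.of_nat r + Z.of_nat d + 1)) * (qp q r / qp q (r + d))
    * zpow q (2 * (Z.of_nat r * Z.of_nat r) + 2 * (Z.of_nat r * Z.of_nat d) + Z.of_nat r)
    * csum (fun k => e k * zpow q (- (Z.of_nat (r + d) * Z.of_nat k))
                     * qp q (r + k + d) * binv q r k) (S r).
Proof.
  intros hq q0. unfold bailey_sum. rewrite (Cmult_comm (csum _ _)), <- !csum_scal.
  apply csum_ext. intros k Hk. unfold conj_lim, bailey_A, bailey_D. rewrite sgn_add.
  assert (S1 := sgn_sqr r). assert (S2 := sgn_sqr k).
  assert (H1 := qp_nz q (r + d) hq).
  assert (H2 := zpow_nz q (tri r) q0). assert (H3 := zpow_nz q (tri k) q0).
  assert (H4 := zpow_nz q (Z.of_nat r * Z.of_nat k) q0).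
  assert (H5 := zpow_nz q (Z.of_nat k * Z.of_nat d) q0).
  rewrite (Z.mul_comm (Z.of_nat (r + d))), (Z.mul_comm (Z.of_nat r) (Z.of_nat k)) in *.
  generalize dependent (sgn r). intros s1 S1. generalize dependent (sgn k). intros s2 S2.
  generalize dependent (qp q (r + d)). generalize (qp q (r + k + d)). intros P1 P2 HP2.
  (* The signs are now opaque atoms; inserting their squares, which equal 1, makes the identity
     purely rational. *)
  match goal with |- ?a = ?b => transitivity ((s1 * s1) * (s2 * s2) * b) end.
  2:{ rewrite S1, S2. ring. }
  zexpand q0. field. repeat split; auto.
Qed.

Definition hecke_term (rho : Z) (z : C) (x i : nat) : C :=
  let m := (Z.of_nat x * Z.of_nat x - 2 * ((2 * Z.of_nat i + 1) * (2 * Z.of_nat i + 1)))%Z in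
  if (m mod 32 =? rho)%Z then zpow z m else 0.

(* For odd [x] the range of [i] is [2 (2 i + 1) < x]. *)
Definition hecke_row (rho : Z) (z : C) (x : nat) : C :=
  csum (hecke_term rho z x) ((x + 1) / 4).

(** The even part of [g] for [eps = 1], the odd part for [eps = -1]. *)
Definition parity_part (eps : C) (g : C -> C) (p : C) : C := (g p + eps * g (- p)) / 2.

Lemma C2_nz : RtoC 2 <> 0.
Proof. intros E. apply (f_equal fst) in E. simpl in E. lra. Qed.

(** The residue of [16 e + s] mod 32 is [s] or [s + 16] according to the parity of [e], which is the
    parity of [p^e] as a function of [p = z^16]. *)
Lemma hecke_term_parity (z : C) (x i : nat) (e s : Z) (b : bool) : z <> 0 -> (0 <= s < 16)%Z ->
  (Z.of_nat x * Z.of_nat x - 2 * ((2 * Z.of_nat i + 1) * (2 * Z.of_nat i + 1)) = 16 * e + s)%Z ->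
  hecke_term (if b then s else s + 16) z x i
  = zpow z s * parity_part (if b then 1 else - RtoC 1) (fun p => zpow p e) (zpow z 16).
Proof.
  intros z0 hs E. unfold hecke_term, parity_part. rewrite E.
  assert (H := zpow_nz z 16 z0). assert (H2 := C2_nz).
  rewrite zpow_opp_base by assumption.
  rewrite (zpow_add z (16 * e)), <- zpow_zpow by assumption.
  destruct (Z.even e) eqn:Ev.
  - apply Z.even_spec in Ev. destruct Ev as [f ->].
    destruct (Z.eqb_spec ((16 * (2 * f) + s) mod 32) (if b then s else s + 16)) as [A|A];
    replace (16 * (2 * f) + s)%Z with (s + f * 32)%Z in A by ring;
    rewrite Z.mod_add, Z.mod_small in A by lia; destruct b; try lia; field; assumption.
  - assert (Od : Z.odd e = true) by (now rewrite <- Z.negb_even, Ev).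
    apply Z.odd_spec in Od. destruct Od as [f ->].
    destruct (Z.eqb_spec ((16 * (2 * f + 1) + s) mod 32) (if b then s else s + 16)) as [A|A];
    replace (16 * (2 * f + 1) + s)%Z with (s + 16 + f * 32)%Z in A by ring;
    rewrite Z.mod_add, Z.mod_small in A by lia; destruct b; try lia; field; assumption.
Qed.

(** Two Hecke rows written in [p]: since [2 (2i+1)^2 = 16 tri i + 2], a row [x] with
    [x^2 - 2 = 16 a + s] has exponents [16 (a - tri i) + s]. *)
Definition theta_diff (n : nat) (a b : Z) (p : C) : C :=
  csum (fun i => zpow p (a - tri i) + zpow p (b - tri i)) n.

Lemma parity_part_theta (eps p : C) (n : nat) (a b : Z) :
  parity_part eps (theta_diff n a b) p
  = csum (fun i => parity_part eps (fun p => zpow p (a - tri i)) p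
                   + parity_part eps (fun p => zpow p (b - tri i)) p) n.
Proof.
  assert (H := C2_nz).
  transitivity (csum (fun i => / 2 * (zpow p (a - tri i) + zpow p (b - tri i))) n
    + csum (fun i => (/ 2 * eps) * (zpow (- p) (a - tri i) + zpow (- p) (b - tri i))) n).
  - rewrite !csum_scal. unfold parity_part, theta_diff. field; assumption.
  - rewrite <- csum_plus. apply csum_ext. intros. unfold parity_part. field; assumption.
Qed.

Lemma hecke_row_pair (z : C) (x y n : nat) (a b s : Z) (t : bool) : z <> 0 -> (0 <= s < 16)%Z ->
  ((x + 1) / 4 = n)%nat -> ((y + 1) / 4 = n)%nat ->
  (Z.of_nat x * Z.of_nat x - 2 = 16 * a + s)%Z -> (Z.of_nat y * Z.of_nat y - 2 = 16 * b + s)%Z ->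
  hecke_row (if t then s else s + 16) z x + hecke_row (if t then s else s + 16) z y
  = zpow z s * parity_part (if t then 1 else - RtoC 1) (theta_diff n a b) (zpow z 16).
Proof.
  intros z0 hs Hx Hy Ex Ey. unfold hecke_row. rewrite Hx, Hy, parity_part_theta.
  rewrite <- csum_plus, <- csum_scal. apply csum_ext. intros i Hi.
  assert (H := tri_double i).
  rewrite (hecke_term_parity z x i (a - tri i) s t), (hecke_term_parity z y i (b - tri i) s t);
    auto; [ring|nia|nia].
Qed.

(** In [1 - p^{4r+2} = (1-p^{2r+1})(1+p^{2r+1})] the first factor is consumed by [bailey_f_closed];
    the second produces the two rows. *)
Lemma theta_diff_0 (p : C) (r : nat) : (Cmod p < 1)%R -> p <> 0 ->
  (1 - zpow (p * p) (2 * Z.of_nat r + 1))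
    * zpow (p * p) (2 * (Z.of_nat r * Z.of_nat r) + Z.of_nat r) * bailey_f p 0 r
  = theta_diff (2 * r + 1) (4 * (Z.of_nat r * Z.of_nat r) + 3 * Z.of_nat r)
      (4 * (Z.of_nat r * Z.of_nat r) + 5 * Z.of_nat r + 1) p.
Proof.
  intros h p0. destruct (bailey_f_closed p r h p0) as [E _].
  unfold theta_diff.
  rewrite (csum_ext _ (fun i => (zpow p (4 * (Z.of_nat r * Z.of_nat r) + 3 * Z.of_nat r)
    + zpow p (4 * (Z.of_nat r * Z.of_nat r) + 5 * Z.of_nat r + 1)) * zpow p (- tri i))).
  2:{ intros. unfold Z.sub. rewrite !(zpow_add _ _ (- _)) by assumption. ring. }
  rewrite csum_scal, <- E. rewrite !zpow_sqr by assumption.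
  replace (4 * (Z.of_nat r * Z.of_nat r) + 5 * Z.of_nat r + 1)%Z with
    (2 * (2 * (Z.of_nat r * Z.of_nat r)) + (2 * Z.of_nat r + 2 * Z.of_nat r + Z.of_nat r + 1))%Z by ring.
  replace (4 * (Z.of_nat r * Z.of_nat r) + 3 * Z.of_nat r)%Z with
    (2 * (2 * (Z.of_nat r * Z.of_nat r)) + (2 * Z.of_nat r + Z.of_nat r))%Z by ring.
  assert (H := zpow_nz p (Z.of_nat r) p0).
  zexpand p0. field. assumption.
Qed.

(** Here the quotient equals [1 + p^{2r+2}], again giving two rows. The extra [p] aligns the
    exponents with [(x^2 - 17)/16] for [x = 8r+7] and [x = 8r+9]. *)
Lemma theta_diff_1 (p : C) (r : nat) : (Cmod p < 1)%R -> p <> 0 ->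
  p * ((1 - zpow (p * p) (2 * Z.of_nat r + 2)) / (1 - zpow (p * p) (Z.of_nat (S r)))
    * zpow (p * p) (2 * (Z.of_nat r * Z.of_nat r) + 3 * Z.of_nat r) * bailey_f p 1 r)
  = theta_diff (2 * r + 2) (4 * (Z.of_nat r * Z.of_nat r) + 7 * Z.of_nat r + 2)
      (4 * (Z.of_nat r * Z.of_nat r) + 9 * Z.of_nat r + 4) p.
Proof.
  intros h p0. destruct (bailey_f_closed p r h p0) as [_ E].
  assert (H1 := one_minus_zpow_nz (p * p) (Z.of_nat (S r)) (Cmod_sqr_lt_1 p h) ltac:(lia)).
  unfold theta_diff.
  rewrite (csum_ext _ (fun i => (zpow p (4 * (Z.of_nat r * Z.of_nat r) + 7 * Z.of_nat r + 2)
    + zpow p (4 * (Z.of_nat r * Z.of_nat r) + 9 * Z.of_nat r + 4)) * zpow p (- tri i))).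
  2:{ intros. unfold Z.sub. rewrite !(zpow_add _ _ (- _)) by assumption. ring. }
  rewrite csum_scal, <- E. revert H1. rewrite !zpow_sqr by assumption.
  replace (4 * (Z.of_nat r * Z.of_nat r) + 9 * Z.of_nat r + 4)%Z with
    (2 * (2 * (Z.of_nat r * Z.of_nat r)) + (2 * (2 * Z.of_nat r) + 2 * (2 * Z.of_nat r) + Z.of_nat r + 2 + 2))%Z by ring.
  replace (4 * (Z.of_nat r * Z.of_nat r) + 7 * Z.of_nat r + 2)%Z with
    (2 * (2 * (Z.of_nat r * Z.of_nat r)) + (2 * (2 * Z.of_nat r) + 2 * Z.of_nat r + Z.of_nat r + 2))%Z by ring.
  replace (2 * (2 * (Z.of_nat r * Z.of_nat r) + 3 * Z.of_nat r))%Z with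
    (2 * (2 * (Z.of_nat r * Z.of_nat r)) + (2 * (2 * Z.of_nat r) + 2 * Z.of_nat r))%Z by ring.
  assert (H := zpow_nz p (Z.of_nat r) p0).
  zexpand p0. intros H1. field. auto.
Qed.

Lemma opp_nz (p : C) : p <> 0 -> - p <> 0.
Proof. intros h E. apply h. replace p with (- - p) by ring. rewrite E. ring. Qed.

Definition base_coef (q : C) (k : nat) : C := / (qp q k * (1 - zpow q (2 * Z.of_nat k + 1))).

(* Partial fractions: [1/(1-p^m) + 1/(1+p^m) = 2/(1-p^2m)] and
   [1/(1-p^m) - 1/(1+p^m) = 2p^m/(1-p^2m)] for odd [m]. *)
Lemma parity_part_bailey_f (p : C) (d r : nat) (b : bool) : (Cmod p < 1)%R -> p <> 0 ->
  parity_part (if b then 1 else - RtoC 1) (fun p => bailey_f p d r) p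
  = csum (fun k => (base_coef (p * p) k * (if b then 1 else p * zpow (p * p) (Z.of_nat k)))
                     * zpow (p * p) (- (Z.of_nat (r + d) * Z.of_nat k))
                     * qp (p * p) (r + k + d) * binv (p * p) r k) (S r).
Proof.
  intros h p0. unfold parity_part, bailey_f.
  replace (- p * - p) with (p * p) by ring.
  rewrite <- csum_scal, <- csum_plus. unfold Cdiv at 1. rewrite Cmult_comm, <- csum_scal.
  apply csum_ext. intros k Hk. unfold base_coef.
  assert (H1 := one_minus_zpow_nz p (2 * Z.of_nat k + 1) h ltac:(lia)).
  assert (H2 := one_minus_zpow_nz (- p) (2 * Z.of_nat k + 1) ltac:(now rewrite Cmod_opp) ltac:(lia)).
  assert (H3 := one_minus_zpow_nz (p * p) (2 * Z.of_nat k + 1) (Cmod_sqr_lt_1 p h) ltac:(lia)).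
  assert (Z.even (2 * Z.of_nat k + 1) = false) by (rewrite Z.add_comm, Z.even_add_mul_2; reflexivity).
  rewrite zpow_opp_base in * by assumption. rewrite H in *.
  assert (H4 := qp_nz (p * p) k (Cmod_sqr_lt_1 p h)).
  assert (H5 := C2_nz).
  rewrite (zpow_sqr p (2 * _ + 1)) in * by assumption. rewrite (zpow_double p (2 * _ + 1)) in * by assumption.
  replace (p * zpow (p * p) (Z.of_nat k)) with (zpow p (2 * Z.of_nat k + 1))
    by (rewrite zpow_sqr, zpow_add, zpow_1 by assumption; ring).
  set (w := zpow p (2 * Z.of_nat k + 1)) in *. clearbody w.
  replace (1 - - (1) * w) with (1 + w) in * by ring.
  destruct b; field; repeat split; auto.
Qed.

Definition coef_plain (q : C) (k : nat) : C := sgn k * zpow q (tri k) * base_coef q k.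

(** [s = 1] serves L1 and [s = -1] serves L4, whereas L2 and L3 use [coef_plain]. *)
Definition coef_shift (q : C) (s : Z) (k : nat) : C :=
  sgn k * zpow q (tri k) * (base_coef q k * zpow q (s * Z.of_nat k)).

Lemma parity_part_theta_0 (eps p : C) (r : nat) : (Cmod p < 1)%R -> p <> 0 ->
  (1 - zpow (p * p) (2 * Z.of_nat r + 1))
    * zpow (p * p) (2 * (Z.of_nat r * Z.of_nat r) + Z.of_nat r)
    * parity_part eps (fun p => bailey_f p 0 r) p
  = parity_part eps (theta_diff (2 * r + 1) (4 * (Z.of_nat r * Z.of_nat r) + 3 * Z.of_nat r)
      (4 * (Z.of_nat r * Z.of_nat r) + 5 * Z.of_nat r + 1)) p.
Proof.
  intros h p0. unfold parity_part.
  rewrite <- !theta_diff_0 by (assumption || (now rewrite Cmod_opp) || now apply opp_nz).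
  replace (- p * - p) with (p * p) by ring. field; exact C2_nz.
Qed.

(** Multiplication by [p] exchanges even and odd parts, hence [- eps]. *)
Lemma parity_part_theta_1 (eps p : C) (r : nat) : (Cmod p < 1)%R -> p <> 0 ->
  p * ((1 - zpow (p * p) (2 * Z.of_nat r + 2)) / (1 - zpow (p * p) (Z.of_nat (S r)))
    * zpow (p * p) (2 * (Z.of_nat r * Z.of_nat r) + 3 * Z.of_nat r))
    * parity_part eps (fun p => bailey_f p 1 r) p
  = parity_part (- eps) (theta_diff (2 * r + 2) (4 * (Z.of_nat r * Z.of_nat r) + 7 * Z.of_nat r + 2)
      (4 * (Z.of_nat r * Z.of_nat r) + 9 * Z.of_nat r + 4)) p.
Proof.
  intros h p0. unfold parity_part.
  rewrite <- !theta_diff_1 by (assumption || (now rewrite Cmod_opp) || now apply opp_nz).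
  replace (- p * - p) with (p * p) by ring.
  assert (H1 := one_minus_zpow_nz (p * p) (Z.of_nat (S r)) (Cmod_sqr_lt_1 p h) ltac:(lia)).
  field; auto using C2_nz.
Qed.

Lemma zpow_lt_1 (z : C) (a : Z) : (Cmod z < 1)%R -> (0 < a)%Z -> (Cmod (zpow z a) < 1)%R.
Proof.
  intros h ha. rewrite <- (Z2Nat.id a), zpow_nat, Cmod_pow by lia.
  apply pow_lt_1_compat; [|lia]. split; [apply Cmod_ge_0|assumption].
Qed.

Lemma bailey_row_7 (z : C) (r : nat) : (Cmod z < 1)%R -> z <> 0 ->
  zpow z 7 * (bailey_sum (zpow z 32) 0 (coef_plain (zpow z 32)) r * conj_lim (zpow z 32) 0 r)
  = hecke_row 7 z (8 * r + 3) + hecke_row 7 z (8 * r + 5).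
Proof.
  intros h z0. assert (p0 := zpow_nz z 16 z0). assert (hp := zpow_lt_1 z 16 h ltac:(lia)).
  (* The exponents are [(x^2 - 9)/16] for the two rows; 0 and 2 are the remainders of [x + 1] modulo
     4. *)
  rewrite (hecke_row_pair z (8 * r + 3) (8 * r + 5) (2 * r + 1)
    (4 * (Z.of_nat r * Z.of_nat r) + 3 * Z.of_nat r)
    (4 * (Z.of_nat r * Z.of_nat r) + 5 * Z.of_nat r + 1) 7 true) by (assumption || lia ||
    (symmetry; (apply Nat.div_unique with 0%nat + apply Nat.div_unique with 2%nat); lia)).
  change (zpow z 32) with (zpow z (2 * 16)). rewrite zpow_double by assumption.
  assert (q0 := Cmult_neq_0 _ _ p0 p0). assert (hq := Cmod_sqr_lt_1 _ hp).
  set (p := zpow z 16) in *. f_equal.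
  unfold coef_plain. rewrite bailey_term by assumption.
  rewrite <- parity_part_theta_0, (parity_part_bailey_f p 0 r true) by assumption.
  rewrite Nat.add_0_r. change (Z.of_nat 0) with 0%Z. rewrite !Z.mul_0_r, !Z.add_0_r.
  replace (qp (p * p) r / qp (p * p) r) with (RtoC 1) by (field; now apply qp_nz).
  rewrite Cmult_1_r. f_equal. apply csum_ext. intros. ring.
Qed.

(** Rests on [q^{-k}/(1-q^{2k+1}) = q^{-k} + q^{k+1}/(1-q^{2k+1})]. The first part sums by
    [sum_qp_ratio] to [q^{-r(r+1)}], which after the prefactors is the subtracted
    [q^{r^2} - q^{(r+1)^2}]; the second is [p] times the odd part. *)
Lemma bailey_row_23 (z : C) (r : nat) : (Cmod z < 1)%R -> z <> 0 ->
  zpow z (- 9) * (bailey_sum (zpow z 32) 0 (coef_shift (zpow z 32) (- 1)) r * conj_lim (zpow z 32) 0 r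
    - (zpow (zpow z 32) (Z.of_nat (r * r)) - zpow (zpow z 32) (Z.of_nat (S r * S r))))
  = hecke_row 23 z (8 * r + 3) + hecke_row 23 z (8 * r + 5).
Proof.
  intros h z0. assert (p0 := zpow_nz z 16 z0). assert (hp := zpow_lt_1 z 16 h ltac:(lia)).
  change (hecke_row 23 z) with (hecke_row (7 + 16) z).
  rewrite (hecke_row_pair z (8 * r + 3) (8 * r + 5) (2 * r + 1)
    (4 * (Z.of_nat r * Z.of_nat r) + 3 * Z.of_nat r)
    (4 * (Z.of_nat r * Z.of_nat r) + 5 * Z.of_nat r + 1) 7 false) by (assumption || lia ||
    (symmetry; (apply Nat.div_unique with 0%nat + apply Nat.div_unique with 2%nat); lia)).
  change (zpow z 32) with (zpow z (2 * 16)). rewrite zpow_double by assumption.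
  replace (zpow z 7) with (zpow z (- 9) * zpow z 16) by (now rewrite <- zpow_add).
  assert (q0 := Cmult_neq_0 _ _ p0 p0). assert (hq := Cmod_sqr_lt_1 _ hp).
  set (p := zpow z 16) in *. rewrite <- Cmult_assoc. f_equal.
  unfold coef_shift. rewrite bailey_term by assumption.
  rewrite <- parity_part_theta_0, (parity_part_bailey_f p 0 r false) by assumption.
  rewrite (csum_ext _ (fun k => qp (p * p) (r + k)
      * zpow (p * p) (- (Z.of_nat (S r) * Z.of_nat k)) * binv (p * p) r k / qp (p * p) k
    + p * (base_coef (p * p) k * (p * zpow (p * p) (Z.of_nat k))
                     * zpow (p * p) (- (Z.of_nat (r + 0) * Z.of_nat k))
                     * qp (p * p) (r + k + 0) * binv (p * p) r k))).
  2:{ intros k Hk. rewrite !Nat.add_0_r. unfold base_coef.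
      assert (H1 := one_minus_zpow_nz (p * p) (2 * Z.of_nat k + 1) hq ltac:(lia)).
      assert (H2 := qp_nz (p * p) k hq).
      assert (H3 := zpow_nz (p * p) (Z.of_nat k) q0).
      assert (H4 := zpow_nz (p * p) (Z.of_nat r * Z.of_nat k) q0).
      replace (-1 * Z.of_nat k)%Z with (- Z.of_nat k)%Z by ring.
      revert H1. zexpand q0. intros H1. field. auto. }
  rewrite csum_plus, csum_scal, sum_qp_ratio by assumption.
  rewrite Nat.add_0_r. change (Z.of_nat 0) with 0%Z. rewrite !Z.mul_0_r, !Z.add_0_r.
  replace (qp (p * p) r / qp (p * p) r) with (RtoC 1) by (field; now apply qp_nz).
  rewrite !Nat2Z.inj_mul.
  set (u := csum _ _).
  assert (H3 := zpow_nz (p * p) (Z.of_nat r) q0).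
  assert (H4 := zpow_nz (p * p) (Z.of_nat r * Z.of_nat r) q0).
  zexpand q0. field. auto.
Qed.

Lemma bailey_row_31 (z : C) (r : nat) : (Cmod z < 1)%R -> z <> 0 ->
  zpow z 31 * (bailey_sum (zpow z 32) 1 (coef_plain (zpow z 32)) r * conj_lim (zpow z 32) 1 r)
  = hecke_row 31 z (8 * r + 7) + hecke_row 31 z (8 * r + 9).
Proof.
  intros h z0. assert (p0 := zpow_nz z 16 z0). assert (hp := zpow_lt_1 z 16 h ltac:(lia)).
  change (hecke_row 31 z) with (hecke_row (15 + 16) z).
  rewrite (hecke_row_pair z (8 * r + 7) (8 * r + 9) (2 * r + 2)
    (4 * (Z.of_nat r * Z.of_nat r) + 7 * Z.of_nat r + 2)
    (4 * (Z.of_nat r * Z.of_nat r) + 9 * Z.of_nat r + 4) 15 false) by (assumption || lia ||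
    (symmetry; (apply Nat.div_unique with 0%nat + apply Nat.div_unique with 2%nat); lia)).
  change (zpow z 32) with (zpow z (2 * 16)). rewrite zpow_double by assumption.
  (* The factor [z^16 = p] is the one [parity_part_theta_1] asks for; it turns the even part into an
     odd one, hence residue [15 + 16]. *)
  replace (zpow z 31) with (zpow z 15 * zpow z 16) by (now rewrite <- zpow_add).
  assert (q0 := Cmult_neq_0 _ _ p0 p0). assert (hq := Cmod_sqr_lt_1 _ hp).
  set (p := zpow z 16) in *. rewrite <- Cmult_assoc. f_equal.
  unfold coef_plain. rewrite bailey_term by assumption.
  rewrite <- (parity_part_theta_1 (RtoC 1)), (parity_part_bailey_f p 1 r true) by assumption.
  rewrite (csum_ext (fun k => base_coef _ _ * 1 * _ * _ * _) (fun k => base_coef (p * p) k * zpow (p * p) (- (Z.of_nat (r + 1) * Z.of_nat k)) *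
    qp (p * p) (r + k + 1) * binv (p * p) r k)) by (intros; ring).
  rewrite Nat.add_1_r, qp_S.
  assert (H1 := one_minus_zpow_nz (p * p) (Z.of_nat (S r)) hq ltac:(lia)).
  assert (H2 := qp_nz (p * p) r hq).
  replace (2 * Z.of_nat r + Z.of_nat 1 + 1)%Z with (2 * Z.of_nat r + 2)%Z by lia.
  replace (2 * (Z.of_nat r * Z.of_nat r) + 2 * (Z.of_nat r * Z.of_nat 1) + Z.of_nat r)%Z
    with (2 * (Z.of_nat r * Z.of_nat r) + 3 * Z.of_nat r)%Z by lia.
  field. auto.
Qed.

Lemma bailey_row_15 (z : C) (r : nat) : (Cmod z < 1)%R -> z <> 0 ->
  zpow z 47 * (bailey_sum (zpow z 32) 1 (coef_shift (zpow z 32) 1) r * conj_lim (zpow z 32) 1 r)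
  = hecke_row 15 z (8 * r + 7) + hecke_row 15 z (8 * r + 9).
Proof.
  intros h z0. assert (p0 := zpow_nz z 16 z0). assert (hp := zpow_lt_1 z 16 h ltac:(lia)).
  rewrite (hecke_row_pair z (8 * r + 7) (8 * r + 9) (2 * r + 2)
    (4 * (Z.of_nat r * Z.of_nat r) + 7 * Z.of_nat r + 2)
    (4 * (Z.of_nat r * Z.of_nat r) + 9 * Z.of_nat r + 4) 15 true) by (assumption || lia ||
    (symmetry; (apply Nat.div_unique with 0%nat + apply Nat.div_unique with 2%nat); lia)).
  change (zpow z 32) with (zpow z (2 * 16)). rewrite zpow_double by assumption.
  (* One factor [p] is for [parity_part_theta_1], the other for the numerators [p q^k] of the odd
     part. *)
  replace (zpow z 47) with (zpow z 15 * (zpow z 16 * zpow z 16)) by (now rewrite <- !zpow_add).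
  assert (q0 := Cmult_neq_0 _ _ p0 p0). assert (hq := Cmod_sqr_lt_1 _ hp).
  set (p := zpow z 16) in *. rewrite <- Cmult_assoc. f_equal.
  unfold coef_shift. rewrite bailey_term by assumption.
  replace (parity_part 1 (theta_diff _ _ _)) with (parity_part (- - RtoC 1)
    (theta_diff (2 * r + 2) (4 * (Z.of_nat r * Z.of_nat r) + 7 * Z.of_nat r + 2)
      (4 * (Z.of_nat r * Z.of_nat r) + 9 * Z.of_nat r + 4))) by (f_equal; ring).
  rewrite <- parity_part_theta_1, (parity_part_bailey_f p 1 r false) by assumption.
  rewrite (csum_ext (fun k => base_coef _ _ * (p * _) * _ * _ * _) (fun k => p * (base_coef (p * p) k *
    zpow (p * p) (1 * Z.of_nat k) * zpow (p * p) (- (Z.of_nat (r + 1) * Z.of_nat k)) *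
    qp (p * p) (r + k + 1) * binv (p * p) r k))) by (intros; rewrite Z.mul_1_l; ring).
  rewrite csum_scal, Nat.add_1_r, qp_S.
  assert (H1 := one_minus_zpow_nz (p * p) (Z.of_nat (S r)) hq ltac:(lia)).
  assert (H2 := qp_nz (p * p) r hq).
  replace (2 * Z.of_nat r + Z.of_nat 1 + 1)%Z with (2 * Z.of_nat r + 2)%Z by lia.
  replace (2 * (Z.of_nat r * Z.of_nat r) + 2 * (Z.of_nat r * Z.of_nat 1) + Z.of_nat r)%Z
    with (2 * (Z.of_nat r * Z.of_nat r) + 3 * Z.of_nat r)%Z by lia.
  field. auto.
Qed.

Lemma coef_plain_shift (q : C) (k : nat) : coef_plain q k = coef_shift q 0 k.
Proof. unfold coef_plain, coef_shift. rewrite Z.mul_0_l, zpow_0. ring. Qed.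

Lemma Cmod_coef_shift (q : C) (s : Z) (k : nat) : (Cmod q < 1)%R -> q <> 0 -> (-1 <= s)%Z ->
  (Cmod (coef_shift q s k) <= qbound q ^ (k + 1) * Cmod (zpow q (tri k - Z.of_nat k)))%R.
Proof.
  intros hq q0 hs.
  assert (H1 := one_minus_zpow_nz q (2 * Z.of_nat k + 1) hq ltac:(lia)).
  assert (H2 := qp_nz q k hq).
  replace (coef_shift q s k) with (/ qp q k * / (1 - zpow q (2 * Z.of_nat k + 1))
    * (zpow q (tri k - Z.of_nat k) * zpow q ((s + 1) * Z.of_nat k) * sgn k)).
  - rewrite pow_add, pow_1. apply Cmod_mult_le.
    + apply Cmod_mult_le; [now apply Cmod_inv_qp|].
      apply Cmod_inv_one_minus_zpow; [assumption|lia].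
    + rewrite !Cmod_mult, Cmod_sgn, Rmult_1_r.
      rewrite <- (Rmult_1_r (Cmod (zpow q (tri k - Z.of_nat k)))) at 2.
      apply Rmult_le_compat_l; [apply Cmod_ge_0|].
      apply Cmod_zpow_le_1; [lra|nia].
  - unfold coef_shift, base_coef. rewrite <- zpow_add by assumption.
    replace (tri k - Z.of_nat k + (s + 1) * Z.of_nat k)%Z with (tri k + s * Z.of_nat k)%Z by ring.
    rewrite (zpow_add q (tri k)) by assumption. field. auto.
Qed.

(** * The four summands in Bailey form *)

Lemma pow_n_binom2 (q : C) (m n : nat) : q <> 0 ->
  pow_n q (binom2 (m + 1) + binom2 (n + 1)) = zpow q (tri m) * zpow q (tri n).
Proof.
  intros q0. rewrite <- zpow_add by assumption. unfold tri.
  rewrite <- Nat2Z.inj_add, zpow_nat, !Nat.add_1_r. reflexivity.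
Qed.

Lemma pow_n_binom2_pred (q : C) (m n : nat) : q <> 0 ->
  pow_n q (binom2 (m + 1) + binom2 n) = zpow q (tri m) * (zpow q (tri n) * zpow q (- Z.of_nat n)).
Proof.
  intros q0. rewrite <- !zpow_add by assumption. unfold tri.
  replace (_ + _)%Z with (Z.of_nat (binom2 (m + 1) + binom2 n)).
  - rewrite zpow_nat. reflexivity.
  - rewrite Nat.add_1_r. rewrite (binom2_S n). lia.
Qed.

Lemma L2_term_bailey (q : C) (n : nat) : (Cmod q < 1)%R -> q <> 0 ->
  L2_term q n = bailey_delta q 0 n * csum (fun k => coef_plain q k * binv q n k) (S n).
Proof.
  intros hq q0. unfold L2_term. rewrite sum_n_m_csum, <- csum_scal.
  apply csum_ext. intros k Hk. rewrite pow_n_binom2, sgn_add, binv_le by (assumption || lia).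
  unfold cdiv, coef_plain, bailey_delta, base_coef.
  replace (2 * Z.of_nat k + 1)%Z with (Z.of_nat (2 * k + 1)) by lia.
  assert (H1 := one_minus_zpow_nz q (Z.of_nat (2 * k + 1)) hq ltac:(lia)).
  rewrite zpow_nat in *. change (Z.of_nat 0) with 0%Z. rewrite Z.mul_0_r, Z.add_0_r.
  change (@pow_n C_Ring q (2 * k + 1)) with (q ^ (2 * k + 1)).
  assert (H2 := qp_nz q k hq). assert (H3 := qp_nz q (n - k) hq). field. auto.
Qed.

Lemma L4_term_bailey (q : C) (n : nat) : (Cmod q < 1)%R -> q <> 0 ->
  L4_term q n = bailey_delta q 0 n * csum (fun k => coef_shift q (-1) k * binv q n k) (S n).
Proof.
  intros hq q0. unfold L4_term. rewrite sum_n_m_csum, <- csum_scal.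
  apply csum_ext. intros k Hk. rewrite pow_n_binom2_pred, sgn_add, binv_le by (assumption || lia).
  unfold cdiv, coef_shift, bailey_delta, base_coef.
  replace (2 * Z.of_nat k + 1)%Z with (Z.of_nat (2 * k + 1)) by lia.
  assert (H1 := one_minus_zpow_nz q (Z.of_nat (2 * k + 1)) hq ltac:(lia)).
  rewrite (zpow_nat _ (2 * k + 1)) in *. change (Z.of_nat 0) with 0%Z. rewrite Z.mul_0_r, Z.add_0_r.
  change (@pow_n C_Ring q (2 * k + 1)) with (q ^ (2 * k + 1)).
  replace (-1 * Z.of_nat k)%Z with (- Z.of_nat k)%Z by ring.
  assert (H2 := qp_nz q k hq). assert (H3 := qp_nz q (n - k) hq). field. auto.
Qed.

(** Shifting [n] and [k] by one adds [n + 1] and [k + 1] to the exponent: [q^n] accounts for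
    [d = 1], [q^k] for the shift 1, and [q * q] is left over. *)
Lemma L1_term_bailey (q : C) (n : nat) : (Cmod q < 1)%R -> q <> 0 ->
  L1_term q (S n) = q * q * (bailey_delta q 1 n * csum (fun k => coef_shift q 1 k * binv q n k) (S n)).
Proof.
  intros hq q0. unfold L1_term. rewrite <- sum_n_m_S, sum_n_m_csum, <- !csum_scal.
  apply csum_ext. intros k Hk. rewrite pow_n_binom2, sgn_add, !sgn_S, binv_le by (assumption || lia).
  unfold cdiv, coef_shift, bailey_delta, base_coef. simpl (S n - S k)%nat.
  replace (S n - 1)%nat with n by lia. replace (S k - 1)%nat with k by lia.
  replace (2 * S k - 1)%nat with (2 * k + 1)%nat by lia.
  replace (2 * Z.of_nat k + 1)%Z with (Z.of_nat (2 * k + 1)) by lia.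
  assert (H1 := one_minus_zpow_nz q (Z.of_nat (2 * k + 1)) hq ltac:(lia)).
  rewrite (zpow_nat _ (2 * k + 1)) in *. change (Z.of_nat 1) with 1%Z. rewrite !tri_S.
  change (@pow_n C_Ring q (2 * k + 1)) with (q ^ (2 * k + 1)).
  assert (H2 := qp_nz q k hq). assert (H3 := qp_nz q (n - k) hq). zexpand q0. field. auto.
Qed.

Lemma L3_term_bailey (q : C) (n : nat) : (Cmod q < 1)%R -> q <> 0 ->
  L3_term q (S n) = q * (bailey_delta q 1 n * csum (fun k => coef_plain q k * binv q n k) (S n)).
Proof.
  intros hq q0. unfold L3_term. rewrite <- sum_n_m_S, sum_n_m_csum, <- !csum_scal.
  apply csum_ext. intros k Hk. rewrite pow_n_binom2_pred, sgn_add, !sgn_S, binv_le by (assumption || lia).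
  unfold cdiv, coef_plain, bailey_delta, base_coef. simpl (S n - S k)%nat.
  replace (S n - 1)%nat with n by lia. replace (S k - 1)%nat with k by lia.
  replace (2 * S k - 1)%nat with (2 * k + 1)%nat by lia.
  replace (2 * Z.of_nat k + 1)%Z with (Z.of_nat (2 * k + 1)) by lia.
  assert (H1 := one_minus_zpow_nz q (Z.of_nat (2 * k + 1)) hq ltac:(lia)).
  rewrite (zpow_nat _ (2 * k + 1)) in *. change (Z.of_nat 1) with 1%Z. rewrite !tri_S.
  change (@pow_n C_Ring q (2 * k + 1)) with (q ^ (2 * k + 1)).
  assert (H4 := zpow_nz q (Z.of_nat k) q0).
  assert (H2 := qp_nz q k hq). assert (H3 := qp_nz q (n - k) hq). zexpand q0. field. auto.
Qed.

Lemma L1_term_0 (q : C) : L1_term q 0 = 0.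
Proof. unfold L1_term. rewrite sum_n_m_zero by lia. reflexivity. Qed.

Lemma L3_term_0 (q : C) : L3_term q 0 = 0.
Proof. unfold L3_term. rewrite sum_n_m_zero by lia. reflexivity. Qed.

(** * Ideals of Z[sqrt 2] *)

(** Pigeonhole for a relation: congruence modulo an arbitrary ideal is not decidable, so the map is
    chosen with [epsilon]. *)
Lemma relation_injective_le (P : nat -> nat -> Prop) (m n : nat) :
  (forall i, (i < m)%nat -> exists j, (j < n)%nat /\ P i j) ->
  (forall i i' j, (i < m)%nat -> (i' < m)%nat -> P i j -> P i' j -> i = i') ->
  (m <= n)%nat.
Proof.
  intros H1 H2.
  set (f := fun i => epsilon (inhabits O) (fun j => (j < n)%nat /\ P i j)).
  assert (Hf : forall i, (i < m)%nat -> (f i < n)%nat /\ P i (f i)).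
  { intros i Hi. apply (epsilon_spec (inhabits O) (fun j => (j < n)%nat /\ P i j)). auto. }
  assert (N : NoDup (map f (seq 0 m))).
  { apply NoDup_map_NoDup_ForallPairs; [|apply seq_NoDup].
    intros i j Hi Hj E. apply in_seq in Hi, Hj.
    apply (H2 i j (f i)); [lia|lia|apply Hf; lia|rewrite E; apply Hf; lia]. }
  assert (I : incl (map f (seq 0 m)) (seq 0 n)).
  { intros x Hx. apply in_map_iff in Hx. destruct Hx as [i [<- Hi]]. apply in_seq in Hi.
    apply in_seq. split; [lia|]. apply Hf. lia. }
  apply NoDup_incl_length in I; [|assumption]. now rewrite length_map, !length_seq in I.
Qed.

Definition OK_norm (a : OK) : Z := (fst a * fst a - 2 * (snd a * snd a))%Z.

Definition OK_conj (a : OK) : OK := (fst a, - snd a)%Z.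

Definition principal (a : OK) : OK -> Prop := fun b => exists r, b = OK_mul r a.

Ltac ok_ring := unfold OK_norm, OK_conj, OK_mul, OK_add, OK_sub; cbn [fst snd]; try apply (f_equal2 pair); ring.

Lemma OK_eta (a : OK) : a = (fst a, snd a).
Proof. now destruct a. Qed.

Lemma OK_mul_assoc (a b c : OK) : OK_mul a (OK_mul b c) = OK_mul (OK_mul a b) c.
Proof. ok_ring. Qed.

Lemma OK_norm_mul (a b : OK) : OK_norm (OK_mul a b) = (OK_norm a * OK_norm b)%Z.
Proof. ok_ring. Qed.

Lemma principal_is_ideal (a : OK) : is_ideal (principal a).
Proof.
  repeat split.
  - exists (0, 0)%Z. ok_ring.
  - intros x y [r ->] [s ->]. exists (OK_add r s). ok_ring.
  - intros s x [r ->]. exists (OK_mul s r). ok_ring.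
Qed.

Lemma ideal_sub (I : OK -> Prop) (a b : OK) : is_ideal I -> I a -> I b -> I (OK_sub a b).
Proof.
  intros [_ [Hadd Hmul]] Ha Hb.
  replace (OK_sub a b) with (OK_add a (OK_mul (-1, 0)%Z b)) by (unfold OK_sub; ok_ring).
  auto.
Qed.

Lemma ideal_norm_le (I : OK -> Prop) (m n : nat) :
  is_ideal I -> ideal_norm_is I m -> ideal_norm_is I n -> (m <= n)%nat.
Proof.
  intros HI [f [Hf1 Hf2]] [g [Hg1 Hg2]].
  apply relation_injective_le with (fun i j => I (OK_sub (f i) (g j))).
  - intros i _. apply Hg2.
  - intros i i' j Hi Hi' H1 H2. apply Hf1; auto.
    replace (OK_sub (f i) (f i')) with (OK_sub (OK_sub (f i) (g j)) (OK_sub (f i') (g j)))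
      by ok_ring.
    now apply ideal_sub.
Qed.

Lemma ideal_norm_unique (I : OK -> Prop) (m n : nat) :
  is_ideal I -> ideal_norm_is I m -> ideal_norm_is I n -> m = n.
Proof. intros. apply Nat.le_antisymm; eapply ideal_norm_le; eauto. Qed.

Lemma same_set_norm (I J : OK -> Prop) (m : nat) :
  same_set I J -> ideal_norm_is I m -> ideal_norm_is J m.
Proof.
  intros E [f [H1 H2]]. exists f. split.
  - intros i j Hi Hj H. apply H1; auto. now apply E.
  - intros x. destruct (H2 x) as [i [Hi H]]. exists i. split; [assumption|]. now apply E.
Qed.

(** For a lattice with basis [(c, g)], [(n, 0)] the rectangle [[0,n) x [0,g)] represents the
    quotient: the second coordinate is reduced first, then the first. *)
Lemma lattice_norm (I : OK -> Prop) (c : Z) (n g : nat) : (0 < n)%nat -> (0 < g)%nat ->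
  (forall b, I b <-> exists s t, b = (c * s + Z.of_nat n * t, Z.of_nat g * s)%Z) ->
  ideal_norm_is I (n * g).
Proof.
  intros hn hg HI.
  exists (fun i => (Z.of_nat (i mod n), Z.of_nat (i / n))). split.
  - intros i j Hi Hj H. apply HI in H. destruct H as [s [t E]].
    unfold OK_sub in E. cbn [fst snd] in E. injection E as E1 E2.
    assert (Bi : (i / n < g)%nat) by (apply Nat.Div0.div_lt_upper_bound; lia).
    assert (Bj : (j / n < g)%nat) by (apply Nat.Div0.div_lt_upper_bound; lia).
    assert (Mi := Nat.mod_upper_bound i n ltac:(lia)).
    assert (Mj := Nat.mod_upper_bound j n ltac:(lia)).
    assert (s = 0)%Z by nia. subst s.
    assert (t = 0)%Z by nia. subst t.
    rewrite (Nat.div_mod_eq i n), (Nat.div_mod_eq j n).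
    replace (i / n)%nat with (j / n)%nat by lia. lia.
  - intros [a b].
    set (b0 := (b mod Z.of_nat g)%Z). set (s := (b / Z.of_nat g)%Z).
    set (a' := (a - c * s)%Z).
    assert (B0 := Z.mod_pos_bound b (Z.of_nat g) ltac:(lia)).
    assert (A0 := Z.mod_pos_bound a' (Z.of_nat n) ltac:(lia)).
    assert (Eb := Z.div_mod b (Z.of_nat g) ltac:(lia)).
    assert (Ea := Z.div_mod a' (Z.of_nat n) ltac:(lia)).
    fold b0 in B0, Eb. fold s in Eb. set (t := (a' / Z.of_nat n)%Z) in *.
    set (a0 := (a' mod Z.of_nat n)%Z) in *.
    exists (Z.to_nat b0 * n + Z.to_nat a0)%nat. split; [nia|].
    rewrite Nat.div_add_l, Nat.div_small, Nat.add_0_r by lia.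
    rewrite Nat.add_comm, Nat.Div0.mod_add, Nat.mod_small by lia.
    apply HI. exists s, t. unfold OK_sub. cbn [fst snd]. rewrite !Z2Nat.id by lia.
    f_equal; unfold a' in *; lia.
Qed.

(* Hermite normal form: with [g = gcd x y], [x = g x'], [y = g y'] and [e x' + h y' = 1],
   the substitution [(u,v) = s (h,e) + t (x',-y')] is unimodular. *)
Lemma principal_norm (x y : Z) (m : nat) : (0 < m)%nat ->
  (x * x - 2 * (y * y) = Z.of_nat m)%Z -> ideal_norm_is (principal (x, y)) m.
Proof.
  intros hm E.
  assert (Hg : (0 < Z.gcd x y)%Z).
  { assert (H := Z.gcd_nonneg x y). destruct (Z.eq_dec (Z.gcd x y) 0) as [G|G]; [|lia].
    apply Z.gcd_eq_0 in G. destruct G; subst. lia. }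
  destruct (Z.gcd_divide_l x y) as [x' Hx]. destruct (Z.gcd_divide_r x y) as [y' Hy].
  destruct (Z.gcd_bezout x y _ eq_refl) as [e [h Hb]].
  set (g := Z.gcd x y) in *. clearbody g.
  assert (B : (e * x' + h * y' = 1)%Z) by (subst x y; nia).
  set (n := (g * (x' * x' - 2 * (y' * y')))%Z).
  assert (Hn : (Z.of_nat m = n * g)%Z) by (unfold n; rewrite <- E; subst x y; ring).
  assert (Hn0 : (0 < n)%Z) by nia.
  replace m with (Z.to_nat n * Z.to_nat g)%nat by nia.
  (* The first coordinate of the product of [(h, e)] and [(x, y)], whose second coordinate is
     [g]. *)
  apply lattice_norm with (x * h + 2 * (y * e))%Z; [lia|lia|].
  intros b. rewrite !Z2Nat.id by lia. split.
  - intros [[u v] ->]. exists (x' * v + y' * u)%Z, (e * u - h * v)%Z.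
    unfold OK_mul; cbn [fst snd]. unfold n. rewrite Hx, Hy.
    f_equal.
    + transitivity ((e * x' + h * y') * (u * (x' * g) + 2 * v * (y' * g)))%Z; [rewrite B; ring|].
      ring.
    + ring.
  - intros [s [t ->]]. exists (s * h + t * x', s * e - t * y')%Z.
    unfold OK_mul; cbn [fst snd]. unfold n. rewrite Hx, Hy. f_equal; [ring|].
    transitivity (g * s * (e * x' + h * y'))%Z; [rewrite B; ring|ring].
Qed.

(** Descent: [x = 2 a] gives [y^2 = 2 a^2] with [|y| < |x|]. *)
Lemma sqrt2_irrational (x y : Z) : (x * x = 2 * (y * y))%Z -> x = 0%Z /\ y = 0%Z.
Proof.
  assert (H : forall n x y, (Z.abs x < Z.of_nat n)%Z -> (x * x = 2 * (y * y))%Z -> x = 0%Z).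
  { clear. induction n as [|n IH]; intros x y Hx E; [lia|].
    destruct (Z.eq_dec x 0) as [|Hx0]; [assumption|].
    destruct (Z.Even_or_Odd x) as [[a ->]|[a ->]]; [|lia].
    assert (y = 0%Z) by (apply (IH y a); nia). nia. }
  intros E. assert (x = 0%Z) by (apply (H (Z.to_nat (Z.abs x + 1)) x y); [lia|assumption]).
  split; nia.
Qed.

Lemma OK_norm_nz (a : OK) : a <> (0, 0)%Z -> OK_norm a <> 0%Z.
Proof.
  intros Ha E. apply Ha. destruct a as [x y]. unfold OK_norm in E. cbn [fst snd] in E.
  destruct (sqrt2_irrational x y ltac:(lia)) as [-> ->]. reflexivity.
Qed.

Lemma round_div (u n : Z) : n <> 0%Z -> exists s, (2 * Z.abs (u - n * s) <= Z.abs n)%Z.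
Proof.
  intros hn. assert (H := Z.div_mod (2 * u + Z.abs n) (2 * Z.abs n) ltac:(lia)).
  assert (H1 := Z.mod_pos_bound (2 * u + Z.abs n) (2 * Z.abs n) ltac:(lia)).
  set (k := ((2 * u + Z.abs n) / (2 * Z.abs n))%Z) in *.
  exists (k * Z.sgn n)%Z. replace (n * (k * Z.sgn n))%Z with (k * (n * Z.sgn n))%Z by ring.
  replace (n * Z.sgn n)%Z with (Z.abs n) by lia. nia.
Qed.

(** Both coordinates of [b / a] are rounded with error at most 1/2, so the error has norm at most
    [2/4] in absolute value. *)
Lemma OK_euclid (a b : OK) : a <> (0, 0)%Z ->
  exists s, (Z.abs (OK_norm (OK_sub b (OK_mul s a))) < Z.abs (OK_norm a))%Z.
Proof.
  intros Ha. apply OK_norm_nz in Ha.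
  destruct (round_div (fst (OK_mul b (OK_conj a))) (OK_norm a) Ha) as [s Hs].
  destruct (round_div (snd (OK_mul b (OK_conj a))) (OK_norm a) Ha) as [t Ht].
  exists (s, t). set (e := (fst _ - _)%Z) in Hs. set (f := (snd _ - _)%Z) in Ht.
  set (n := OK_norm a) in *.
  assert (E : (OK_norm (OK_sub b (OK_mul (s, t) a)) * n = e * e - 2 * (f * f))%Z).
  { unfold e, f, n. ok_ring. }
  set (k := OK_norm (OK_sub b (OK_mul (s, t) a))) in *. clearbody k e f n.
  assert (He : (4 * (e * e) <= n * n)%Z) by nia.
  assert (Hf : (4 * (f * f) <= n * n)%Z) by nia.
  assert (H : (Z.abs k * Z.abs n < Z.abs n * Z.abs n)%Z) by (rewrite <- !Z.abs_mul, E; nia).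
  nia.
Qed.

(** A nonzero element of least absolute norm generates: the Euclidean remainder of any other element
    lies in [I] and must be 0. *)
Lemma ideal_principal (I : OK -> Prop) (a0 : OK) : is_ideal I -> I a0 -> a0 <> (0, 0)%Z ->
  exists a, a <> (0, 0)%Z /\ same_set I (principal a).
Proof.
  intros HI. remember (Z.to_nat (Z.abs (OK_norm a0))) as n eqn:En.
  revert a0 En. induction n as [n IH] using (well_founded_induction lt_wf).
  intros a En Ha Ha0.
  destruct (classic (exists b, I b /\ b <> (0, 0)%Z /\ (Z.abs (OK_norm b) < Z.abs (OK_norm a))%Z))
    as [[b [Hb [Hb0 Hlt]]]|Hmin].
  - apply (IH (Z.to_nat (Z.abs (OK_norm b)))) with b; auto. lia.
  - exists a. split; [assumption|]. intros b. split.
    + intros Hb. destruct (OK_euclid a b Ha0) as [s Hs]. exists s.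
      set (r := OK_sub b (OK_mul s a)) in *.
      assert (Hr : I r) by (apply ideal_sub; auto; apply HI; assumption).
      assert (Hr0 : r = (0, 0)%Z).
      { apply NNPP. intros Hr0. apply Hmin. now exists r. }
      replace b with (OK_add r (OK_mul s a)).
      * rewrite Hr0. rewrite (OK_eta (OK_mul s a)). reflexivity.
      * rewrite (OK_eta b). unfold r. ok_ring.
    + intros [s ->]. now apply HI.
Qed.

(** Otherwise the integers [0, ..., m] would occupy [m + 1] distinct classes among [m]. *)
Lemma ideal_nonzero (I : OK -> Prop) (m : nat) : is_ideal I -> ideal_norm_is I m ->
  exists a, I a /\ a <> (0, 0)%Z.
Proof.
  intros HI [f [H1 H2]]. apply NNPP. intros Hno.
  assert (S m <= m)%nat; [|lia].
  apply relation_injective_le with (fun i j => I (OK_sub (Z.of_nat i, 0%Z) (f j))).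
  - intros i _. apply H2.
  - intros i i' j _ _ Hi Hi'.
    assert (H := ideal_sub _ _ _ HI Hi Hi').
    apply NNPP. intros Hne. apply Hno. eexists. split; [exact H|].
    unfold OK_sub. cbn [fst snd]. intros E. injection E as E1 E2. lia.
Qed.

Lemma principal_unit (a u v : OK) : OK_mul v u = (1, 0)%Z ->
  same_set (principal a) (principal (OK_mul u a)).
Proof.
  intros E b. split; intros [r ->].
  - exists (OK_mul r v). rewrite OK_mul_assoc, <- (OK_mul_assoc r v u), E.
    f_equal. destruct r. ok_ring.
  - exists (OK_mul r u). apply OK_mul_assoc.
Qed.

Lemma same_set_trans (I J K : OK -> Prop) : same_set I J -> same_set J K -> same_set I K.
Proof. intros H1 H2 x. now rewrite (H1 x). Qed.

Lemma generator_pos_norm (a : OK) : a <> (0, 0)%Z ->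
  exists b, same_set (principal a) (principal b) /\ (0 < OK_norm b)%Z.
Proof.
  intros Ha. apply OK_norm_nz in Ha. destruct (Z_lt_le_dec 0 (OK_norm a)).
  - exists a. split; [now intros x|assumption].
  (* The unit [1 + sqrt 2] has norm -1 and inverse [-1 + sqrt 2]. *)
  - exists (OK_mul (1, 1)%Z a). split; [now apply principal_unit with (-1, 1)%Z|].
    rewrite OK_norm_mul. change (OK_norm (1, 1)%Z) with (-1)%Z. lia.
Qed.

(* Multiplication by powers of the unit [3 + 2 sqrt 2] moves [y/x] into [[-1/2, 1/2]]. *)
Lemma generator_reduced (a : OK) : (0 < OK_norm a)%Z ->
  exists x y, same_set (principal a) (principal (x, y)) /\
    (x * x - 2 * (y * y) = OK_norm a)%Z /\ (0 < x)%Z /\ (2 * Z.abs y <= x)%Z.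
Proof.
  assert (P : forall n x y, (x < Z.of_nat n)%Z -> (0 < x)%Z -> (0 < x * x - 2 * (y * y))%Z ->
    exists x' y', same_set (principal (x, y)) (principal (x', y')) /\
    (x' * x' - 2 * (y' * y') = x * x - 2 * (y * y))%Z /\ (0 < x')%Z /\ (2 * Z.abs y' <= x')%Z).
  { clear. induction n as [|n IH]; intros x y Hn Hx Hm; [lia|].
    destruct (Z_lt_le_dec x (2 * Z.abs y)) as [H|H].
    2:{ exists x, y. split; [now intros b|auto]. }
    assert (S : (Z.sgn y * Z.sgn y = 1)%Z) by (destruct y; simpl in *; lia).
    set (s := Z.sgn y) in *. assert (Y : (s * y = Z.abs y)%Z) by (unfold s; lia).
    (* With this sign the first coordinate decreases, since [x < 2|y|], and stays positive, since
       [x^2 > 2y^2]. *)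
    assert (E : OK_mul (3, - (2 * s))%Z (x, y) = (3 * x - 4 * Z.abs y, 3 * y - 2 * s * x)%Z)
      by (unfold OK_mul; cbn [fst snd]; apply (f_equal2 pair); nia).
    assert (N : ((3 * x - 4 * Z.abs y) * (3 * x - 4 * Z.abs y)
        - 2 * ((3 * y - 2 * s * x) * (3 * y - 2 * s * x)) = x * x - 2 * (y * y))%Z).
    { rewrite <- Y. transitivity (9 * x * x - 18 * y * y + (s * s) * (16 * y * y - 8 * x * x))%Z; [ring|].
      rewrite S. ring. }
    destruct (IH (3 * x - 4 * Z.abs y)%Z (3 * y - 2 * s * x)%Z) as [x' [y' [H1 [H2 [H3 H4]]]]];
      [lia|nia|rewrite N; assumption|].
    exists x', y'. rewrite N in H2. split; [|auto].
    apply same_set_trans with (2 := H1). rewrite <- E. apply principal_unit with (3, 2 * s)%Z.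
    unfold OK_mul; cbn [fst snd]; apply (f_equal2 pair); nia. }
  intros Ha. destruct a as [x y]. unfold OK_norm in *. cbn [fst snd] in *.
  destruct (Z_lt_le_dec 0 x).
  - apply (P (Z.to_nat (x + 1))); lia.
  - destruct (P (Z.to_nat (- x + 1)) (- x)%Z (- y)%Z) as [x' [y' [H1 [H2 H3]]]]; [lia|nia|lia|].
    exists x', y'. split; [|split; [lia|assumption]].
    apply same_set_trans with (2 := H1).
    replace (- x, - y)%Z with (OK_mul (-1, 0)%Z (x, y)) by (unfold OK_mul; cbn [fst snd]; apply (f_equal2 pair); ring).
    apply principal_unit with (-1, 0)%Z. reflexivity.
Qed.

(** The quotient of the generators is a unit [a + b sqrt 2] of norm 1 with [b m = y' x - y x'].
    Reducedness gives [|b| m <= x x' < 2 m], so [|b| <= 1]; [|b| = 1] would need [a^2 = 3]. Hence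
    the quotient is 1 or -1, and positivity of [x], [x'] excludes -1. *)
Lemma reduced_generator_unique (x y x' y' m : Z) :
  (x * x - 2 * (y * y) = m)%Z -> (x' * x' - 2 * (y' * y') = m)%Z ->
  (0 < x)%Z -> (0 < x')%Z -> (2 * Z.abs y < x)%Z -> (2 * Z.abs y' < x')%Z ->
  same_set (principal (x, y)) (principal (x', y')) -> (x, y) = (x', y').
Proof.
  intros E E' hx hx' hy hy' HS.
  assert (Hm : (0 < m)%Z) by nia.
  assert (H : principal (x, y) (x', y')) by (apply HS; exists (1, 0)%Z; unfold OK_mul; cbn [fst snd]; apply (f_equal2 pair); ring).
  destruct H as [[a b] H]. assert (HN := f_equal OK_norm H). rewrite OK_norm_mul in HN.
  assert (H1 := f_equal fst H). assert (H2 := f_equal snd H).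
  unfold OK_mul in H1, H2. cbn [fst snd] in H1, H2.
  unfold OK_norm in HN. cbn [fst snd] in HN. rewrite E, E' in HN.
  assert (U : (a * a - 2 * (b * b) = 1)%Z) by nia.
  assert (Eb : (b * m = y' * x - y * x')%Z) by (rewrite H1, H2, <- E; ring).
  assert (B1 : (2 * m > x * x)%Z) by nia. assert (B2 : (2 * m > x' * x')%Z) by nia.
  assert (B3 : (Z.abs (y' * x) * 2 <= x' * x)%Z).
  { rewrite Z.abs_mul, (Z.abs_eq x) by lia. assert (0 <= (x' - 2 * Z.abs y') * x)%Z by (apply Z.mul_nonneg_nonneg; lia). lia. }
  assert (B4 : (Z.abs (y * x') * 2 <= x' * x)%Z).
  { rewrite Z.abs_mul, (Z.abs_eq x') by lia. assert (0 <= (x - 2 * Z.abs y) * x')%Z by (apply Z.mul_nonneg_nonneg; lia). lia. }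
  assert (B5 : (x' * x < 2 * m)%Z).
  { destruct (Z.le_ge_cases x x') as [L|L]; [assert (x' * x <= x' * x')%Z|assert (x' * x <= x * x)%Z];
    (apply Z.mul_le_mono_nonneg_l || apply Z.mul_le_mono_nonneg_r || idtac); lia. }
  assert (Hb : (Z.abs b < 2)%Z).
  { assert (B6 : (Z.abs b * m <= x' * x)%Z).
    { rewrite <- (Z.abs_eq m) at 1 by lia. rewrite <- Z.abs_mul, Eb. lia. }
    apply Z.nle_gt. intros L. assert (2 * m <= Z.abs b * m)%Z by (apply Z.mul_le_mono_nonneg_r; lia). lia. }
  assert (Hb0 : b = 0%Z).
  { assert (b = 0 \/ b = 1 \/ b = -1)%Z as [|[|]] by lia; [assumption| |]; subst b; exfalso;
    assert (A3 : (Z.abs a * Z.abs a = 3)%Z) by lia;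
    assert (Z.abs a = 0 \/ Z.abs a = 1 \/ 2 <= Z.abs a)%Z as [A|[A|A]] by lia; try (rewrite A in A3; lia);
    assert (2 * 2 <= Z.abs a * Z.abs a)%Z by (apply Z.mul_le_mono_nonneg; lia); lia. }
  subst b. assert (a = 1 \/ a = -1)%Z as [|] by nia; subst a.
  - f_equal; lia.
  - lia.
Qed.

(** * Counting ideals by reduced generators *)

Definition hecke_exp (x i : nat) : Z :=
  (Z.of_nat x * Z.of_nat x - 2 * ((2 * Z.of_nat i + 1) * (2 * Z.of_nat i + 1)))%Z.

Definition hecke_solution (m : nat) (p : nat * nat) : bool :=
  ((snd p <? (fst p + 1) / 4)%nat && (hecke_exp (fst p) (snd p) =? Z.of_nat m)%Z)%bool.

(** The search box is independent of [m], so that one [K] serves all [m < K] in a partial sum. *)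
Definition hecke_solutions (K m : nat) : list (nat * nat) :=
  filter (hecke_solution m) (list_prod (seq 0 K) (seq 0 K)).

Lemma lt_div_4 (x i : nat) : (i < (x + 1) / 4)%nat <-> (4 * i + 3 <= x)%nat.
Proof.
  assert (H := Nat.div_mod_eq (x + 1) 4). assert (H1 := Nat.mod_upper_bound (x + 1) 4 ltac:(lia)).
  lia.
Qed.

Lemma hecke_solutions_spec (K m x i : nat) :
  In (x, i) (hecke_solutions K m) <->
  (x < K /\ i < K /\ 4 * i + 3 <= x)%nat /\ hecke_exp x i = Z.of_nat m.
Proof.
  unfold hecke_solutions. rewrite filter_In, in_prod_iff, !in_seq.
  unfold hecke_solution. cbn [fst snd].
  rewrite Bool.andb_true_iff, Nat.ltb_lt, Z.eqb_eq, lt_div_4. lia.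
Qed.

Lemma NoDup_list_prod (A B : Type) (l : list A) (l' : list B) :
  NoDup l -> NoDup l' -> NoDup (list_prod l l').
Proof.
  intros Hl Hl'. induction Hl as [|a l Ha Hl IH]; [constructor|].
  simpl. apply NoDup_app.
  - apply FinFun.Injective_map_NoDup; [|assumption]. intros x y E. now injection E.
  - assumption.
  - intros [x y] H1 H2. apply in_map_iff in H1. destruct H1 as [z [E _]]. injection E as -> _.
    apply in_prod_iff in H2. tauto.
Qed.

Definition reduced_generators (K m : nat) : list OK :=
  map (fun p => (Z.of_nat (fst p), 2 * Z.of_nat (snd p) + 1)%Z) (hecke_solutions K m)
  ++ map (fun p => (Z.of_nat (fst p), - (2 * Z.of_nat (snd p) + 1))%Z) (hecke_solutions K m).

Lemma reduced_generators_In (K m : nat) (x y : Z) : In (x, y) (reduced_generators K m) ->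
  (x * x - 2 * (y * y) = Z.of_nat m)%Z /\ (0 < x)%Z /\ (2 * Z.abs y < x)%Z.
Proof.
  intros H. apply in_app_or in H. destruct H as [H|H];
  apply in_map_iff in H; destruct H as [[a b] [E H]];
  assert (Ex := f_equal fst E); assert (Ey := f_equal snd E); cbn [fst snd] in Ex, Ey; subst x y; apply hecke_solutions_spec in H;
  unfold hecke_exp in H; lia.
Qed.

Lemma NoDup_reduced_generators (K m : nat) : NoDup (reduced_generators K m).
Proof.
  assert (H : NoDup (hecke_solutions K m))
    by (apply NoDup_filter, NoDup_list_prod; apply seq_NoDup).
  apply NoDup_app.
  - apply FinFun.Injective_map_NoDup; [|assumption]. intros [a b] [c d] E.
    assert (Ex := f_equal fst E). assert (Ey := f_equal snd E). cbn [fst snd] in Ex, Ey. f_equal; lia.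
  - apply FinFun.Injective_map_NoDup; [|assumption]. intros [a b] [c d] E.
    assert (Ex := f_equal fst E). assert (Ey := f_equal snd E). cbn [fst snd] in Ex, Ey. f_equal; lia.
  - intros [x y] H1 H2. apply in_map_iff in H1, H2.
    destruct H1 as [p [E1 _]]. destruct H2 as [p' [E2 _]].
    assert (Ey := f_equal snd E1). assert (Ey' := f_equal snd E2). cbn [fst snd] in Ey, Ey'. lia.
Qed.

(** [m] odd forces [x] odd, and then [y] even would give [m = 1] mod 8. Odd [x] makes [2|y| <= x]
    strict, and reducedness yields [x <= m < K], so the box is large enough. *)
Lemma reduced_generators_complete (K m : nat) (x y : Z) : (m mod 8 = 7)%nat -> (m < K)%nat ->
  (x * x - 2 * (y * y) = Z.of_nat m)%Z -> (0 < x)%Z -> (2 * Z.abs y <= x)%Z ->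
  In (x, y) (reduced_generators K m).
Proof.
  intros Hm HK E Hx Hy.
  assert (Em := Nat.div_mod_eq m 8). rewrite Hm in Em. set (k := (m / 8)%nat) in *.
  destruct (Z.Even_or_Odd x) as [[a Ea]|[a Ea]]; [subst x; lia|].
  destruct (Z.Even_or_Odd y) as [[b Eb]|[b Eb]].
  { exfalso. subst x y. assert (exists c, a * (a + 1) = 2 * c)%Z as [c Hc].
    { destruct (Z.Even_or_Odd a) as [[c ->]|[c ->]]; [exists (c * (2 * c + 1))%Z|exists ((2 * c + 1) * (c + 1))%Z]; ring. }
    lia. }
  assert (Hxm : (x <= Z.of_nat m)%Z) by nia.
  set (i := Z.to_nat ((Z.abs y - 1) / 2)).
  assert (Hi : (Z.abs y = 2 * Z.of_nat i + 1)%Z).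
  { assert (Z.abs y = 2 * b + 1 \/ Z.abs y = 2 * (- b - 1) + 1)%Z as [H|H] by lia; unfold i; rewrite H.
    - replace (2 * b + 1 - 1)%Z with (b * 2)%Z by ring. rewrite Z.div_mul by lia. lia.
    - replace (2 * (- b - 1) + 1 - 1)%Z with ((- b - 1) * 2)%Z by ring. rewrite Z.div_mul by lia. lia. }
  assert (HS : In (Z.to_nat x, i) (hecke_solutions K m)).
  { apply hecke_solutions_spec. split; [lia|]. unfold hecke_exp. rewrite Z2Nat.id, <- Hi by lia.
    rewrite <- Z.abs_mul, Z.abs_eq by nia. assumption. }
  apply in_or_app. destruct (Z.le_ge_cases 0 y); [left|right]; apply in_map_iff;
  exists (Z.to_nat x, i); (split; [|assumption]); cbn [fst snd]; f_equal; lia.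
Qed.

Lemma has_n_ideals_count (K m : nat) : (m mod 8 = 7)%nat -> (m < K)%nat ->
  has_n_ideals_of_norm m (2 * length (hecke_solutions K m)).
Proof.
  intros Hm HK. assert (Hm0 : (0 < m)%nat) by (destruct m; [discriminate|lia]).
  exists (map principal (reduced_generators K m)).
  assert (EL : length (reduced_generators K m) = (2 * length (hecke_solutions K m))%nat).
  { unfold reduced_generators. rewrite length_app, !length_map. lia. }
  split; [|split; [|split]].
  - now rewrite length_map.
  - intros I HI. apply in_map_iff in HI. destruct HI as [[x y] [<- HI]].
    apply reduced_generators_In in HI. split; [apply principal_is_ideal|].
    apply principal_norm; tauto.
  - rewrite <- EL. intros i j Hi Hj HS.
    rewrite !(nth_indep _ (fun _ => False) (principal (0, 0)%Z)) in HS by now rewrite length_map.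
    rewrite !map_nth in HS.
    apply (proj1 (NoDup_nth _ (0, 0)%Z) (NoDup_reduced_generators K m)); auto.
    assert (Ii := nth_In _ (0, 0)%Z Hi). assert (Ij := nth_In _ (0, 0)%Z Hj).
    destruct (nth i _ _) as [x y]. destruct (nth j _ _) as [x' y'].
    apply reduced_generators_In in Ii, Ij.
    apply reduced_generator_unique with (Z.of_nat m); tauto.
  - intros I HI HN.
    destruct (ideal_nonzero I m HI HN) as [a0 [Ha0 Hz]].
    destruct (ideal_principal I a0 HI Ha0 Hz) as [a [Ha Sa]].
    destruct (generator_pos_norm a Ha) as [b [Sb Hb]].
    destruct (generator_reduced b Hb) as [x [y [Sc [E [Hx Hy]]]]].
    assert (HS : same_set I (principal (x, y))) by (eapply same_set_trans; [eassumption|]; eapply same_set_trans; eassumption).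
    assert (En : m = Z.to_nat (OK_norm b)).
    { apply (ideal_norm_unique (principal (x, y))); [apply principal_is_ideal| |].
      - now apply same_set_norm with I.
      - apply principal_norm; lia. }
    exists (principal (x, y)). split; [|assumption].
    apply in_map_iff. exists (x, y). split; [reflexivity|].
    apply reduced_generators_complete; auto. lia.
Qed.

Lemma has_n_ideals_le (m n n' : nat) :
  has_n_ideals_of_norm m n -> has_n_ideals_of_norm m n' -> (n <= n')%nat.
Proof.
  intros [L [EL [L1 [L2 L3]]]] [M [EM [M1 [M2 M3]]]].
  apply relation_injective_le with
    (fun i j => same_set (nth i L (fun _ => False)) (nth j M (fun _ => False))).
  - intros i Hi. destruct (L1 (nth i L (fun _ => False))) as [HI HN]; [apply nth_In; lia|].
    destruct (M3 _ HI HN) as [J [HJ HS]].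
    destruct (In_nth _ _ (fun _ => False) HJ) as [j [Hj E]].
    exists j. split; [lia|]. now rewrite E.
  - intros i i' j Hi Hi' H H'. apply L2; auto.
    intros x. rewrite (H x), (H' x). reflexivity.
Qed.

(** [num_ideals] is an [epsilon] choice: existence of a count gives it its property, and two counts
    agree by [has_n_ideals_le]. *)
Lemma num_ideals_count (K m : nat) : (m mod 8 = 7)%nat -> (m < K)%nat ->
  num_ideals m = (2 * length (hecke_solutions K m))%nat.
Proof.
  intros Hm HK. assert (H := has_n_ideals_count K m Hm HK).
  assert (H1 : has_n_ideals_of_norm m (num_ideals m))
    by (apply (epsilon_spec (inhabits O) (fun n => has_n_ideals_of_norm m n)); eauto).
  apply Nat.le_antisymm; eapply has_n_ideals_le; eauto.
Qed.

Lemma length_filter_csum (f : nat -> bool) (n : nat) :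
  RtoC (INR (length (filter f (seq 0 n)))) = csum (fun i => if f i then 1 else 0) n.
Proof.
  induction n as [|n IH]; [reflexivity|].
  rewrite seq_S, filter_app, length_app, plus_INR, RtoC_plus, IH. simpl. f_equal.
  destruct (f n); reflexivity.
Qed.

Lemma length_filter_prod_csum (f : nat * nat -> bool) (m n : nat) :
  RtoC (INR (length (filter f (list_prod (seq 0 m) (seq 0 n)))))
  = csum (fun x => csum (fun i => if f (x, i) then 1 else 0) n) m.
Proof.
  assert (E : forall l l' t : list nat, list_prod (l ++ l') t = list_prod l t ++ list_prod l' t).
  { intros l l' t. induction l as [|a l IH]; [reflexivity|]. simpl. now rewrite IH, app_assoc. }
  induction m as [|m IH]; [reflexivity|].
  rewrite seq_S, E, filter_app, length_app, plus_INR, RtoC_plus, IH. simpl. f_equal.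
  rewrite app_nil_r, <- length_filter_csum. do 2 f_equal.
  generalize (seq 0 n). induction l as [|a l IHl]; [reflexivity|].
  simpl. destruct (f (m, a)); simpl; now rewrite IHl.
Qed.

Lemma length_hecke_solutions (K m : nat) :
  RtoC (INR (length (hecke_solutions K m)))
  = csum (fun x => csum (fun i => if (hecke_exp x i =? Z.of_nat m)%Z then 1 else 0) ((x + 1) / 4)) K.
Proof.
  unfold hecke_solutions. rewrite length_filter_prod_csum. apply csum_ext. intros x Hx.
  rewrite (csum_extend _ ((x + 1) / 4) K).
  - apply csum_ext. intros i Hi. unfold hecke_solution. cbn [fst snd].
    apply Nat.ltb_lt in Hi. now rewrite Hi.
  - assert (H := Nat.div_mod_eq (x + 1) 4). lia.
  - intros i Hi. unfold hecke_solution. cbn [fst snd].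
    destruct (Nat.ltb_spec i ((x + 1) / 4)); [lia|reflexivity].
Qed.

(** * Convergence *)

Lemma Ccvg_ext (u v : nat -> C) (l : C) : (forall n, u n = v n) -> Ccvg u l -> Ccvg v l.
Proof. intros E. apply is_lim_seq_ext. intros n. now rewrite E. Qed.

Lemma Ccvg_plus (u v : nat -> C) (l m : C) :
  Ccvg u l -> Ccvg v m -> Ccvg (fun n => u n + v n) (l + m).
Proof.
  intros Hu Hv. apply is_lim_seq_le_le with (fun _ => 0%R) (fun n => Cmod (u n - l) + Cmod (v n - m))%R.
  - intros n. split; [apply Cmod_ge_0|].
    replace (u n + v n - (l + m)) with ((u n - l) + (v n - m)) by ring. apply Cmod_triangle.
  - apply is_lim_seq_const.
  - replace (Finite 0) with (Finite (0 + 0)) by (f_equal; ring).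
    now apply is_lim_seq_plus'.
Qed.

Lemma Ccvg_scal (c : C) (u : nat -> C) (l : C) : Ccvg u l -> Ccvg (fun n => c * u n) (c * l).
Proof.
  intros Hu. apply is_lim_seq_ext with (fun n => Cmod c * Cmod (u n - l))%R.
  - intros n. rewrite <- Cmod_mult. f_equal. ring.
  - replace (Finite 0) with (Rbar_mult (Cmod c) 0%R) by (simpl; f_equal; ring).
    now apply is_lim_seq_scal_l.
Qed.

Lemma Ccvg_const (c : C) : Ccvg (fun _ => c) c.
Proof.
  apply is_lim_seq_ext with (fun _ => 0%R); [|apply is_lim_seq_const].
  intros n. replace (c - c) with (RtoC 0) by ring. now rewrite Cmod_0.
Qed.

Lemma Ccvg_subseq (u : nat -> C) (l : C) (phi : nat -> nat) :
  (forall n, (n <= phi n)%nat) -> Ccvg u l -> Ccvg (fun n => u (phi n)) l.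
Proof.
  intros H Hu. apply (is_lim_seq_subseq (fun n => Cmod (u n - l)) 0%R phi); [|assumption].
  intros P [N HN]. exists N. intros n Hn. apply HN. specialize (H n). lia.
Qed.

Lemma sum_n_csum (a : nat -> C) (n : nat) : sum_n a n = csum a (S n).
Proof. unfold sum_n. apply sum_n_m_csum. Qed.

Lemma Ccvg_is_series (a : nat -> C) (l : C) :
  Ccvg (csum a) l -> is_series (V := C_NormedModule) a l.
Proof.
  intros H. apply (is_lim_seq_incr_1 (fun n => Cmod (csum a n - l))) in H.
  apply filterlim_locally. intros eps.
  apply is_lim_seq_spec in H. destruct (H eps) as [N HN]. exists N. intros n Hn.
  apply C_NormedModule_mixin_compat1. specialize (HN n Hn).
  rewrite Rminus_0_r, Rabs_pos_eq in HN by apply Cmod_ge_0.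
  rewrite sum_n_csum. exact HN.
Qed.

Lemma is_series_Ccvg (a : nat -> C) (l : C) :
  is_series (V := C_NormedModule) a l -> Ccvg (csum a) l.
Proof.
  intros H. apply (is_lim_seq_incr_1 (fun n => Cmod (csum a n - l))).
  apply is_lim_seq_spec. intros eps.
  (* Balls of [C_NormedModule] are coordinatewise, which costs a factor [sqrt 2] in the modulus. *)
  assert (He : (0 < eps / sqrt 2)%R).
  { apply Rdiv_lt_0_compat; [apply cond_pos|]. apply sqrt_lt_R0. lra. }
  destruct (proj1 (filterlim_locally _ _) H (mkposreal _ He)) as [N HN].
  exists N. intros n Hn. specialize (HN n Hn).
  apply C_NormedModule_mixin_compat2 in HN. simpl in HN. rewrite sum_n_csum in HN.
  rewrite Rminus_0_r, Rabs_pos_eq by apply Cmod_ge_0.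
  replace (pos eps) with (sqrt 2 * (eps / sqrt 2))%R; [exact HN|].
  field. apply Rgt_not_eq, sqrt_lt_R0. lra.
Qed.

(** The [n + 1] copies of [t^n] are dominated by [1 + t + ... + t^n]. *)
Lemma INR_S_pow_le (t : R) (n : nat) : (0 <= t < 1)%R -> (INR (S n) * t ^ n <= / (1 - t))%R.
Proof.
  intros ht. assert (H : (INR (S n) * t ^ n * (1 - t) <= 1 - t ^ S n)%R).
  { induction n as [|n IH]; [simpl; lra|].
    rewrite (S_INR (S n)). assert (Hn : (0 <= t ^ n <= 1)%R).
    { split; [apply pow_le; lra|]. rewrite <- (pow1 n). apply pow_incr. lra. }
    assert (H1 : (t ^ S n = t * t ^ n)%R) by reflexivity.
    assert (H2 : (t ^ S (S n) = t * (t * t ^ n))%R) by reflexivity.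
    rewrite H1 in IH. rewrite H2, H1.
    set (y := (t ^ n)%R) in *. set (k := INR (S n)) in *.
    assert (t * (k * y * (1 - t)) <= t * (1 - t * y))%R by (apply Rmult_le_compat_l; lra).
    assert (t * y <= 1)%R by nra. nra. }
  assert (0 <= t ^ S n)%R by (apply pow_le; lra).
  apply Rmult_le_reg_r with (1 - t)%R; [lra|]. rewrite Rinv_l by lra. lra.
Qed.

(** With [r = t^2], one factor [t^n] absorbs [n + 1] and the other leaves a geometric series. *)
Lemma ex_series_INR_pow (r : R) : (0 <= r < 1)%R -> ex_series (fun n => INR (S n) * r ^ n)%R.
Proof.
  intros hr. set (t := sqrt r).
  assert (ht : (0 <= t < 1)%R).
  { split; [apply sqrt_pos|]. unfold t. rewrite <- sqrt_1. apply sqrt_lt_1; lra. }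
  assert (E : r = (t * t)%R) by (unfold t; rewrite sqrt_sqrt; lra).
  apply (ex_series_le (K := R_AbsRing) (V := R_CompleteNormedModule)) with (fun n => / (1 - t) * t ^ n)%R.
  - intros n. change (Rabs (INR (S n) * r ^ n) <= / (1 - t) * t ^ n)%R.
    rewrite E, Rpow_mult_distr, <- Rmult_assoc.
    assert (0 <= t ^ n)%R by (apply pow_le; lra).
    rewrite Rabs_pos_eq by (repeat apply Rmult_le_pos; auto; apply pos_INR).
    apply Rmult_le_compat_r; [assumption|]. now apply INR_S_pow_le.
  - apply (ex_series_scal (V := R_NormedModule) (/ (1 - t))%R (fun n => t ^ n)%R).
    apply ex_series_geom. rewrite Rabs_pos_eq; lra.
Qed.

Lemma sqr_pow_lim (r : R) : (0 <= r < 1)%R -> is_lim_seq (fun n => INR n * (INR n * r ^ n))%R 0%R.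
Proof.
  intros hr. set (t := sqrt r).
  assert (ht : (0 <= t < 1)%R).
  { split; [apply sqrt_pos|]. unfold t. rewrite <- sqrt_1. apply sqrt_lt_1; lra. }
  assert (E : r = (t * t)%R) by (unfold t; rewrite sqrt_sqrt; lra).
  assert (H := ex_series_lim_0 _ (ex_series_INR_pow t ht)).
  apply is_lim_seq_le_le with (fun _ => 0%R) (fun n => (INR (S n) * t ^ n) * (INR (S n) * t ^ n))%R.
  - intros n. assert (H0 := pos_INR n). assert (H1 : (0 <= t ^ n)%R) by (apply pow_le; lra).
    assert (H2 : (0 <= r ^ n)%R) by (apply pow_le; lra).
    split; [repeat apply Rmult_le_pos; auto|].
    rewrite E, Rpow_mult_distr, S_INR. set (y := (t ^ n)%R) in *. set (k := INR n) in *.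
    assert (0 <= k * y)%R by (apply Rmult_le_pos; auto). nra.
  - apply is_lim_seq_const.
  - replace (Finite 0) with (Finite (0 * 0)) by (f_equal; ring).
    now apply is_lim_seq_mult'.
Qed.

(** * Summation of the ideal counts *)

(** Gives the decay [|z|^x] of row [x], and confines exponents below [K] to rows below [K]. *)
Lemma hecke_exp_ge (x i : nat) : (i < (x + 1) / 4)%nat -> (Z.of_nat x <= hecke_exp x i)%Z.
Proof. intros H. apply lt_div_4 in H. unfold hecke_exp. nia. Qed.

Lemma hecke_term_exp (rho : Z) (z : C) (x i : nat) :
  hecke_term rho z x i = if (hecke_exp x i mod 32 =? rho)%Z then zpow z (hecke_exp x i) else 0.
Proof. reflexivity. Qed.

Lemma Cmod_hecke_term (rho : Z) (z : C) (x i n : nat) : (Cmod z < 1)%R ->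
  (Z.of_nat n <= hecke_exp x i)%Z -> (Cmod (hecke_term rho z x i) <= Cmod z ^ n)%R.
Proof.
  intros h H. rewrite hecke_term_exp. assert (H0 := Cmod_ge_0 z).
  destruct (_ =? _)%Z.
  - rewrite <- (Z2Nat.id (hecke_exp x i)), zpow_nat, Cmod_pow by lia.
    replace (Z.to_nat (hecke_exp x i)) with (n + (Z.to_nat (hecke_exp x i) - n))%nat by lia.
    rewrite pow_add.
    rewrite <- (Rmult_1_r (Cmod z ^ n)) at 2.
    apply Rmult_le_compat_l; [now apply pow_le|].
    rewrite <- (pow1 (Z.to_nat (hecke_exp x i) - n)). apply pow_incr. lra.
  - rewrite Cmod_0. now apply pow_le.
Qed.

Lemma div_4_le (x : nat) : ((x + 1) / 4 <= x)%nat.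
Proof. assert (H := Nat.div_mod_eq (x + 1) 4). lia. Qed.

Lemma hecke_row_summable (rho : Z) (z : C) : (Cmod z < 1)%R ->
  exists h, Ccvg (csum (hecke_row rho z)) h.
Proof.
  intros h. assert (H0 := Cmod_ge_0 z).
  assert (H : ex_series (K := C_AbsRing) (V := C_NormedModule) (hecke_row rho z)).
  { apply (ex_series_le (K := C_AbsRing) (V := C_CompleteNormedModule)) with
      (fun n => INR (S n) * Cmod z ^ n)%R; [|now apply ex_series_INR_pow].
    intros n. change (Cmod (hecke_row rho z n) <= INR (S n) * Cmod z ^ n)%R.
    apply Rle_trans with (INR ((n + 1) / 4) * Cmod z ^ n)%R.
    - apply Cmod_csum_le. intros i Hi. apply Cmod_hecke_term; [assumption|].
      now apply hecke_exp_ge.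
    - apply Rmult_le_compat_r; [now apply pow_le|]. apply le_INR.
      assert (H1 := div_4_le n). lia. }
  destruct H as [l Hl]. exists l. now apply is_series_Ccvg.
Qed.

Lemma csum_indicator (e : Z) (g : nat -> C) (K : nat) : (0 <= e)%Z ->
  csum (fun m => if (e =? Z.of_nat m)%Z then g m else 0) K
  = if (e <? Z.of_nat K)%Z then g (Z.to_nat e) else 0.
Proof.
  intros he. induction K as [|K IH].
  - destruct (Z.ltb_spec e (Z.of_nat 0)); [lia|reflexivity].
  - simpl csum. rewrite IH. destruct (Z.eqb_spec e (Z.of_nat K)) as [->|H].
    + rewrite Nat2Z.id. destruct (Z.ltb_spec (Z.of_nat K) (Z.of_nat K)); [lia|].
      destruct (Z.ltb_spec (Z.of_nat K) (Z.of_nat (S K))); [ring|lia].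
    + destruct (Z.ltb_spec e (Z.of_nat K)); destruct (Z.ltb_spec e (Z.of_nat (S K))); try lia; ring.
Qed.

Lemma csum_ideal_term (rho : nat) (z : C) (K : nat) : (rho mod 8 = 7)%nat ->
  csum (ideal_term rho z) K
  = 2 * csum (fun x => csum (fun i => if (hecke_exp x i <? Z.of_nat K)%Z
      then hecke_term (Z.of_nat rho) z x i else 0) ((x + 1) / 4)) K.
Proof.
  intros hrho. rewrite <- csum_scal.
  transitivity (csum (fun m => csum (fun x => 2 * csum (fun i =>
    if (hecke_exp x i =? Z.of_nat m)%Z then (if (m mod 32 =? rho)%nat then z ^ m else 0) else 0)
      ((x + 1) / 4)) K) K).
  - apply csum_ext. intros m Hm. unfold ideal_term.
    rewrite csum_scal. destruct (Nat.eqb_spec (m mod 32) rho) as [E|E].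
    + assert (Hm8 : (m mod 8 = 7)%nat).
      { transitivity ((m mod 32) mod 8)%nat; [|now rewrite E].
        assert (H1 := Nat.div_mod_eq m 32).
        replace m with (m mod 32 + (4 * (m / 32)) * 8)%nat at 1 by lia.
        now rewrite Nat.Div0.mod_add. }
      rewrite (num_ideals_count K m Hm8 Hm), mult_INR, RtoC_mult, length_hecke_solutions.
      change (@pow_n C_Ring z m) with (z ^ m). change (RtoC (INR 2)) with (RtoC 2).
      rewrite <- Cmult_assoc, (Cmult_comm _ (z ^ m)), <- csum_scal. f_equal.
      apply csum_ext. intros x Hx. rewrite <- csum_scal. apply csum_ext. intros i Hi.
      destruct (_ =? _)%Z; ring.
    + symmetry. rewrite (csum_zero _ K); [ring|]. intros x Hx. apply csum_zero. intros i Hi.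
      destruct (_ =? _)%Z; reflexivity.
  - rewrite csum_swap. apply csum_ext. intros x Hx. rewrite csum_scal. f_equal.
    rewrite csum_swap. apply csum_ext. intros i Hi.
    assert (He := hecke_exp_ge x i Hi).
    rewrite (csum_indicator _ (fun m => if (m mod 32 =? rho)%nat then z ^ m else 0)) by lia.
    destruct (_ <? _)%Z; [|reflexivity]. rewrite hecke_term_exp.
    assert (Hn : exists n, hecke_exp x i = Z.of_nat n)
      by (exists (Z.to_nat (hecke_exp x i)); lia).
    destruct Hn as [n ->]. rewrite Nat2Z.id, zpow_nat.
    change 32%Z with (Z.of_nat 32). rewrite <- Nat2Z.inj_mod.
    destruct (Nat.eqb_spec (n mod 32) rho) as [E|E];
    destruct (Z.eqb_spec (Z.of_nat (n mod 32)) (Z.of_nat rho)); lia || reflexivity.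
Qed.

(** Truncating by [m < K] and by [x < K] differ by [D K]: at most [K^2] terms, each with exponent at
    least [K]. *)
Lemma Ccvg_ideal_term (rho : nat) (z h : C) : (Cmod z < 1)%R -> (rho mod 8 = 7)%nat ->
  Ccvg (csum (hecke_row (Z.of_nat rho) z)) h -> Ccvg (csum (ideal_term rho z)) (2 * h).
Proof.
  intros hz hrho Hh. assert (H0 := Cmod_ge_0 z).
  set (D := fun K => csum (fun x => csum (fun i => if (hecke_exp x i <? Z.of_nat K)%Z
      then 0 else hecke_term (Z.of_nat rho) z x i) ((x + 1) / 4)) K).
  assert (HD : Ccvg D 0).
  { apply Ccvg_0_le with (fun n => INR n * (INR n * Cmod z ^ n))%R; [|apply sqr_pow_lim; lra].
    intros K. apply Cmod_csum_le. intros x Hx.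
    apply Rle_trans with (INR ((x + 1) / 4) * Cmod z ^ K)%R.
    - apply Cmod_csum_le. intros i Hi. destruct (Z.ltb_spec (hecke_exp x i) (Z.of_nat K)).
      + rewrite Cmod_0. now apply pow_le.
      + now apply Cmod_hecke_term.
    - apply Rmult_le_compat_r; [now apply pow_le|]. apply le_INR. assert (H1 := div_4_le x). lia. }
  apply Ccvg_ext with (fun K => 2 * (csum (hecke_row (Z.of_nat rho) z) K + - (1) * D K)).
  - intros K. rewrite csum_ideal_term by assumption. f_equal. unfold D.
    rewrite <- csum_scal, <- csum_plus. apply csum_ext. intros x Hx. unfold hecke_row.
    rewrite <- csum_scal, <- csum_plus. apply csum_ext. intros i Hi.
    destruct (_ <? _)%Z; ring.
  - replace (2 * h) with (2 * (h + - (1) * 0)) by ring.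
    apply Ccvg_scal, Ccvg_plus; [assumption|]. now apply Ccvg_scal.
Qed.

(** For odd [y], [2y^2 = 2] mod 16, so the residue of [x] alone decides whether a row can
    contribute. *)
Lemma hecke_row_zero (rho : Z) (z : C) (x : nat) :
  ((Z.of_nat x * Z.of_nat x - 2 - rho) mod 16 <> 0)%Z -> hecke_row rho z x = 0.
Proof.
  intros H. apply csum_zero. intros i Hi. rewrite hecke_term_exp.
  destruct (Z.eqb_spec (hecke_exp x i mod 32) rho) as [E|E]; [|reflexivity].
  exfalso. apply H. assert (T := tri_double i). unfold hecke_exp in E.
  assert (Hd := Z.div_mod (Z.of_nat x * Z.of_nat x - 2 * ((2 * Z.of_nat i + 1) * (2 * Z.of_nat i + 1))) 32 ltac:(lia)).
  rewrite E in Hd. set (k := (_ / 32)%Z) in Hd.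
  replace (Z.of_nat x * Z.of_nat x - 2 - rho)%Z with ((2 * k + tri i) * 16)%Z by nia.
  apply Z.mod_mul. lia.
Qed.

Lemma hecke_row_zero_mod (rho : Z) (z : C) (r c : nat) :
  ((Z.of_nat c * Z.of_nat c - 2 - rho) mod 16 <> 0)%Z -> hecke_row rho z (8 * r + c) = 0.
Proof.
  intros H. apply hecke_row_zero. intros E. apply H. rewrite <- E.
  replace (Z.of_nat (8 * r + c) * Z.of_nat (8 * r + c) - 2 - rho)%Z with
    (Z.of_nat c * Z.of_nat c - 2 - rho
     + (4 * Z.of_nat r * Z.of_nat r + Z.of_nat r * Z.of_nat c) * 16)%Z by nia.
  now rewrite Z.mod_add by lia.
Qed.

Lemma csum_blocks_8 (f : nat -> C) (c n : nat) :
  csum f (8 * n + c) = csum f c + csum (fun r => csum (fun j => f (8 * r + (c + j))%nat) 8) n.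
Proof.
  induction n as [|n IH]; [simpl; ring|].
  replace (8 * S n + c)%nat with (S (S (S (S (S (S (S (S (8 * n + c))))))))) by lia.
  assert (E : csum f (S (S (S (S (S (S (S (S (8 * n + c)))))))))
    = csum f (8 * n + c) + csum (fun j => f (8 * n + (c + j))%nat) 8).
  { simpl csum. rewrite <- !Cplus_assoc, Cplus_0_l. repeat (apply f_equal2; [apply f_equal; lia|]).
    f_equal. lia. }
  rewrite E, IH, <- Cplus_assoc. reflexivity.
Qed.

Lemma csum_hecke_row_3_5 (rho : Z) (z : C) (n : nat) : rho = 7%Z \/ rho = 23%Z ->
  csum (hecke_row rho z) (8 * n)
  = csum (fun r => hecke_row rho z (8 * r + 3) + hecke_row rho z (8 * r + 5)) n.
Proof.
  intros hr. rewrite <- (Nat.add_0_r (8 * n)), csum_blocks_8. simpl (csum _ 0). rewrite Cplus_0_l.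
  apply csum_ext. intros r Hr. cbn [csum plus Nat.add].
  rewrite (hecke_row_zero_mod rho z r 0), (hecke_row_zero_mod rho z r 1),
    (hecke_row_zero_mod rho z r 2), (hecke_row_zero_mod rho z r 4),
    (hecke_row_zero_mod rho z r 6), (hecke_row_zero_mod rho z r 7);
    try (destruct hr as [-> | ->]; discriminate). ring.
Qed.

Lemma csum_hecke_row_7_9 (rho : Z) (z : C) (n : nat) : rho = 15%Z \/ rho = 31%Z ->
  csum (hecke_row rho z) (8 * n + 2)
  = csum (fun r => hecke_row rho z (8 * r + 7) + hecke_row rho z (8 * r + 9)) n.
Proof.
  (* The offset 2 keeps rows [8r+7] and [8r+9] in one block; the skipped rows 0 and 1 are empty. *)
  intros hr. rewrite csum_blocks_8.
  replace (csum (hecke_row rho z) 2) with (RtoC 0) by (unfold hecke_row; simpl; ring).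
  rewrite Cplus_0_l. apply csum_ext. intros r Hr. cbn [csum Nat.add].
  rewrite (hecke_row_zero_mod rho z r 2), (hecke_row_zero_mod rho z r 3),
    (hecke_row_zero_mod rho z r 4), (hecke_row_zero_mod rho z r 5),
    (hecke_row_zero_mod rho z r 6), (hecke_row_zero_mod rho z r 8);
    try (destruct hr as [-> | ->]; discriminate). ring.
Qed.

Lemma Ccvg_succ (u : nat -> C) (l : C) : Ccvg (fun n => u (S n)) l -> Ccvg u l.
Proof. intros H. now apply (is_lim_seq_incr_1 (fun n => Cmod (u n - l))). Qed.

Lemma bailey_cvg (q : C) (d : nat) (c : nat -> C) (v : C) : (Cmod q < 1)%R -> q <> 0 ->
  (forall k, (Cmod (c k) <= qbound q ^ (k + 1) * Cmod (zpow q (tri k - Z.of_nat k)))%R) ->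
  Ccvg (fun N => csum (fun r => bailey_sum q d c r * conj_lim q d r) (S N)) v ->
  Ccvg (csum (fun n => bailey_delta q d n * csum (fun k => c k * binv q n k) (S n))) v.
Proof.
  intros hq q0 hc H. apply Ccvg_succ.
  replace v with (0 + v) by ring.
  eapply Ccvg_ext; [|apply Ccvg_plus; [now apply (bailey_limit q d c)|exact H]].
  intros N. cbv beta. ring.
Qed.

Lemma Cmod_coef_plain (q : C) (k : nat) : (Cmod q < 1)%R -> q <> 0 ->
  (Cmod (coef_plain q k) <= qbound q ^ (k + 1) * Cmod (zpow q (tri k - Z.of_nat k)))%R.
Proof. intros. rewrite coef_plain_shift. apply Cmod_coef_shift; auto. lia. Qed.

(** * Limits of the four series *)

Lemma L2_cvg (z h : C) : (Cmod z < 1)%R -> z <> 0 -> Ccvg (csum (hecke_row 7 z)) h ->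
  Ccvg (csum (L2_term (zpow z 32))) (zpow z (-7) * h).
Proof.
  intros hz z0 H. assert (q0 := zpow_nz z 32 z0). assert (hq := zpow_lt_1 z 32 hz ltac:(lia)).
  eapply Ccvg_ext; [intros n; apply csum_ext; intros; symmetry; now apply L2_term_bailey|].
  apply bailey_cvg; auto; [intros; now apply Cmod_coef_plain|].
  apply Ccvg_ext with (fun N => zpow z (-7) * csum (hecke_row 7 z) (8 * S N)).
  - intros N. rewrite csum_hecke_row_3_5, <- csum_scal by auto. apply csum_ext. intros r Hr.
    rewrite <- bailey_row_7, Cmult_assoc, <- zpow_add by assumption.
    change (-7 + 7)%Z with 0%Z. rewrite zpow_0. ring.
  - apply Ccvg_scal, (Ccvg_subseq _ _ (fun N => 8 * S N)%nat); [lia|assumption].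
Qed.

Lemma Ccvg_pow_0 (q : C) (phi : nat -> nat) : (Cmod q < 1)%R -> (forall n, (n <= phi n)%nat) ->
  Ccvg (fun n => q ^ phi n) 0.
Proof.
  intros hq H. apply (Ccvg_subseq (fun n => q ^ n)); [assumption|].
  apply Ccvg_0_le with (fun n => Cmod q ^ n)%R.
  - intros n. rewrite Cmod_pow. lra.
  - apply is_lim_seq_geom. rewrite Rabs_pos_eq; [assumption|apply Cmod_ge_0].
Qed.

Lemma L4_cvg (z h : C) : (Cmod z < 1)%R -> z <> 0 -> Ccvg (csum (hecke_row 23 z)) h ->
  Ccvg (csum (L4_term (zpow z 32))) (1 + zpow z 9 * h).
Proof.
  intros hz z0 H. assert (q0 := zpow_nz z 32 z0). assert (hq := zpow_lt_1 z 32 hz ltac:(lia)).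
  eapply Ccvg_ext; [intros n; apply csum_ext; intros; symmetry; now apply L4_term_bailey|].
  apply bailey_cvg; auto; [intros; apply Cmod_coef_shift; auto; lia|].
  (* The correction terms of [bailey_row_23] telescope to [1 - q^{(N+1)^2}]. *)
  apply Ccvg_ext with (fun N => (1 + - (1) * zpow z 32 ^ (S N * S N)) + zpow z 9 * csum (hecke_row 23 z) (8 * S N)).
  - intros N. rewrite csum_hecke_row_3_5, <- csum_scal by auto.
    set (g := fun r : nat => - zpow (zpow z 32) (Z.of_nat (r * r))).
    rewrite (csum_ext (fun r => bailey_sum _ _ _ _ * _) (fun r => (g (S r) - g r)
      + zpow z 9 * (hecke_row 23 z (8 * r + 3) + hecke_row 23 z (8 * r + 5)))).
    + rewrite csum_plus, csum_telescope. unfold g. rewrite zpow_nat. simpl (Z.of_nat (0 * 0)).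
      rewrite zpow_0. ring.
    + intros r Hr. rewrite <- bailey_row_23, Cmult_assoc, <- zpow_add by assumption.
      change (9 + -9)%Z with 0%Z. rewrite zpow_0. unfold g. ring.
  - apply Ccvg_plus.
    + replace (RtoC 1) with (1 + - (1) * 0) at 1 by ring.
      apply Ccvg_plus; [apply Ccvg_const|]. apply Ccvg_scal.
      apply (Ccvg_pow_0 _ (fun N => S N * S N)%nat); [assumption|]. intros n. nia.
    + apply Ccvg_scal, (Ccvg_subseq _ _ (fun N => 8 * S N)%nat); [lia|assumption].
Qed.

Lemma L1_cvg (z h : C) : (Cmod z < 1)%R -> z <> 0 -> Ccvg (csum (hecke_row 15 z)) h ->
  Ccvg (csum (L1_term (zpow z 32))) (zpow z 17 * h).
Proof.
  intros hz z0 H. assert (q0 := zpow_nz z 32 z0). assert (hq := zpow_lt_1 z 32 hz ltac:(lia)).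
  apply Ccvg_succ.
  eapply Ccvg_ext.
  { intros n. symmetry. rewrite csum_first, L1_term_0, Cplus_0_l.
    erewrite csum_ext by (intros; now apply L1_term_bailey). apply csum_scal. }
  (* [17 = 64 - 47]: the index shift contributes [q * q], and [bailey_row_15] the power 47. *)
  replace (zpow z 17) with (zpow z 32 * zpow z 32 * zpow z (-47)) by (now rewrite <- !zpow_add).
  rewrite <- Cmult_assoc. apply Ccvg_scal.
  apply bailey_cvg; auto; [intros; apply Cmod_coef_shift; auto; lia|].
  apply Ccvg_ext with (fun N => zpow z (-47) * csum (hecke_row 15 z) (8 * S N + 2)).
  - intros N. rewrite csum_hecke_row_7_9, <- csum_scal by auto. apply csum_ext. intros r Hr.
    rewrite <- bailey_row_15, Cmult_assoc, <- zpow_add by assumption.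
    change (-47 + 47)%Z with 0%Z. rewrite zpow_0. ring.
  - apply Ccvg_scal, (Ccvg_subseq _ _ (fun N => 8 * S N + 2)%nat); [lia|assumption].
Qed.

Lemma L3_cvg (z h : C) : (Cmod z < 1)%R -> z <> 0 -> Ccvg (csum (hecke_row 31 z)) h ->
  Ccvg (csum (L3_term (zpow z 32))) (z * h).
Proof.
  intros hz z0 H. assert (q0 := zpow_nz z 32 z0). assert (hq := zpow_lt_1 z 32 hz ltac:(lia)).
  apply Ccvg_succ.
  eapply Ccvg_ext.
  { intros n. symmetry. rewrite csum_first, L3_term_0, Cplus_0_l.
    erewrite csum_ext by (intros; now apply L3_term_bailey). apply csum_scal. }
  replace (z * h) with (zpow z 32 * (zpow z (-31) * h))
    by (rewrite Cmult_assoc, <- zpow_add by assumption; change (32 + -31)%Z with 1%Z; now rewrite zpow_1).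
  apply Ccvg_scal.
  apply bailey_cvg; auto; [intros; now apply Cmod_coef_plain|].
  apply Ccvg_ext with (fun N => zpow z (-31) * csum (hecke_row 31 z) (8 * S N + 2)).
  - intros N. rewrite csum_hecke_row_7_9, <- csum_scal by auto. apply csum_ext. intros r Hr.
    rewrite <- bailey_row_31, Cmult_assoc, <- zpow_add by assumption.
    change (-31 + 31)%Z with 0%Z. rewrite zpow_0. ring.
  - apply Ccvg_scal, (Ccvg_subseq _ _ (fun N => 8 * S N + 2)%nat); [lia|assumption].
Qed.

Lemma is_series_first (a : nat -> C) : (forall n, a (S n) = 0) ->
  is_series (V := C_NormedModule) a (a O).
Proof.
  intros H. apply Ccvg_is_series, Ccvg_succ. apply Ccvg_ext with (fun _ => a O); [|apply Ccvg_const].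
  intros n. rewrite csum_first, csum_zero by auto. ring.
Qed.

Lemma Cpow_0_pos (n : nat) : (0 < n)%nat -> pow_n (K := C_Ring) (RtoC 0) n = RtoC 0.
Proof. destruct n; [lia|]. intros _. apply Cmult_0_l. Qed.

Lemma sum_n_m_zero_fun (f : nat -> C) (m n : nat) : (forall k, f k = 0) -> sum_n_m f m n = RtoC 0.
Proof.
  intros H. rewrite (sum_n_m_ext _ (fun _ => zero)) by (exact H). exact (@sum_n_m_const_zero C_AbelianGroup m n).
Qed.

(* At [q = 0] every inner sum with [n >= 1] carries a positive power of [q]. *)
Lemma L_terms_0 (n : nat) :
  L1_term 0 (S n) = 0 /\ L2_term 0 (S n) = 0 /\ L3_term 0 (S n) = 0 /\ L4_term 0 (S n) = 0.
Proof.
  assert (H : forall k, pow_n (K := C_Ring) (RtoC 0) (binom2 (S n + 1) + k) = RtoC 0).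
  { intros k. apply Cpow_0_pos. rewrite Nat.add_1_r, binom2_S. lia. }
  repeat split; apply sum_n_m_zero_fun; intros k; rewrite H; unfold cdiv; ring.
Qed.

Lemma ideal_term_0 (rho : nat) : (0 < rho < 32)%nat -> is_series (V := C_NormedModule) (ideal_term rho 0) (RtoC 0).
Proof.
  intros h. assert (E : ideal_term rho 0 0 = 0).
  { unfold ideal_term. destruct (Nat.eqb_spec (0 mod 32) rho) as [E|E]; [|reflexivity].
    simpl in E. lia. }
  rewrite <- E at 2. apply is_series_first. intros n. unfold ideal_term.
  destruct (_ =? _)%nat; [|reflexivity]. rewrite Cpow_0_pos by lia. ring.
Qed.

Lemma Cinv_0 : / (RtoC 0) = 0.
Proof. unfold Cinv. simpl. unfold RtoC. f_equal; unfold Rdiv; ring. Qed.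

Theorem theorem1p1 (q : C) (hq : (Cmod q < 1)%R) :
  (exists a b, is_series (L1_term (pow_n q 32)) a /\ is_series (ideal_term 15 q) b /\
     Cmult (Cinv (pow_n q 17)) a = Cmult (Cinv (RtoC 2)) b) /\
  (exists a b, is_series (L2_term (pow_n q 32)) a /\ is_series (ideal_term 7 q) b /\
     Cmult (pow_n q 7) a = Cmult (Cinv (RtoC 2)) b) /\
  (exists a b, is_series (L3_term (pow_n q 32)) a /\ is_series (ideal_term 31 q) b /\
     Cmult (Cinv (pow_n q 33)) (Cmult (pow_n q 32) a) = Cmult (Cinv (RtoC 2)) b) /\
  (exists a b, is_series (L4_term (pow_n q 32)) a /\ is_series (ideal_term 23 q) b /\
     Cmult (Cinv (pow_n q 9)) (Cplus (RtoC (-1)) a) = Cmult (Cinv (RtoC 2)) b).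
Proof.
  (* At [q = 0] the laws of [zpow] fail, but both sides are 0: every prefactor is a positive power
     of 0 or its inverse, and [/ 0 = 0]. *)
  destruct (excluded_middle_informative (q = 0)) as [->|q0].
  - assert (H0 : forall n, pow_n (K := C_Ring) (RtoC 0) (S n) = RtoC 0) by (intros; apply Cpow_0_pos; lia).
    rewrite !H0.
    split; [|split; [|split]].
    + exists (L1_term 0 0), (RtoC 0). split; [apply is_series_first; intros n; apply (L_terms_0 n)|].
      split; [apply ideal_term_0; lia|]. rewrite ?Cinv_0. ring.
    + exists (L2_term 0 0), (RtoC 0). split; [apply is_series_first; intros n; apply (L_terms_0 n)|].
      split; [apply ideal_term_0; lia|]. rewrite ?Cinv_0. ring.
    + exists (L3_term 0 0), (RtoC 0). split; [apply is_series_first; intros n; apply (L_terms_0 n)|].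
      split; [apply ideal_term_0; lia|]. rewrite ?Cinv_0. ring.
    + exists (L4_term 0 0), (RtoC 0). split; [apply is_series_first; intros n; apply (L_terms_0 n)|].
      split; [apply ideal_term_0; lia|]. rewrite ?Cinv_0. ring.
  - assert (P := fun n => Cpow_nz q n q0).
    assert (H2 := C2_nz).
    assert (E : forall n, pow_n (K := C_Ring) q n = q ^ n) by reflexivity.
    (* These Hecke sums link the two sides: each ideal series converges to twice such a value, each
       L series to a power of [q] times it, plus 1 for L4. *)
    destruct (hecke_row_summable 15 q hq) as [h1 C1]. destruct (hecke_row_summable 7 q hq) as [h2 C2].
    destruct (hecke_row_summable 31 q hq) as [h3 C3]. destruct (hecke_row_summable 23 q hq) as [h4 C4].
    change (pow_n q 32) with (zpow q 32).
    split; [|split; [|split]].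
    + exists (zpow q 17 * h1), (2 * h1). split; [now apply Ccvg_is_series, L1_cvg|].
      split; [now apply Ccvg_is_series, Ccvg_ideal_term|].
      change (zpow q 17) with (q ^ 17). rewrite E. specialize (P 17%nat).
      set (x := q ^ 17) in *. field. auto.
    + exists (zpow q (-7) * h2), (2 * h2). split; [now apply Ccvg_is_series, L2_cvg|].
      split; [now apply Ccvg_is_series, Ccvg_ideal_term|].
      change (zpow q (-7)) with (/ q ^ 7). rewrite E. specialize (P 7%nat).
      set (x := q ^ 7) in *. field. auto.
    + exists (q * h3), (2 * h3). split; [now apply Ccvg_is_series, L3_cvg|].
      split; [now apply Ccvg_is_series, Ccvg_ideal_term|].
      change (zpow q 32) with (q ^ 32). change (pow_n q 33) with (q * q ^ 32). specialize (P 32%nat).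
      set (x := q ^ 32) in *. field. auto.
    + exists (1 + zpow q 9 * h4), (2 * h4). split; [now apply Ccvg_is_series, L4_cvg|].
      split; [now apply Ccvg_is_series, Ccvg_ideal_term|].
      change (zpow q 9) with (q ^ 9). rewrite E. specialize (P 9%nat).
      set (x := q ^ 9) in *. field. auto.
Qed.
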